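(* Let $q>2$, $\delta\ge 1$, $M>0$, $T>0$, $N\ge 1$, and let $p$ be the conjugate exponent of $q$ ($1/p+1/q=1$). Let $u:\mathbb{R}^N\times[0,T]\to\mathbb{R}$ be a continuous function which is a viscosity supersolution of $$u_t-\delta M^-[u(\cdot,t)](x)+\delta|Du|^q+\delta=0\quad\text{in }\mathbb{R}^N\times(0,T)$$ and a viscosity subsolution of $$u_t-\delta M^+[u(\cdot,t)](x)+\frac1\delta|Du|^q-\delta=0\quad\text{in }\mathbb{R}^N\times(0,T),$$ and such that $|u|\le M$ in $\mathbb{R}^N\times[0,T]$. Then for any $\tau\in(0,T)$ there are constants $\theta=\theta(\delta,M,N,q)>p$ and $C(\tau)=C(\tau,\delta,M,N,q)>0$ (depending only on the indicated quantities) such that $$|u(x_1,t_1)-u(x_2,t_2)|\le C(\tau)\left[|x_1-x_2|^{(\theta-p)/(\theta-1)}+|t_1-t_2|^{(\theta-p)/\theta}\right]$$ for any $(x_1,t_1),(x_2,t_2)\in\mathbb{R}^N\times[\tau,T]$.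
   Context: $\mathbf{B}$ denotes the closed unit ball of $\mathbb{R}^N$. For $\phi\in\mathcal{C}^2_b(\mathbb{R}^N)$ (bounded continuous functions with continuous second order derivatives), $$M^-[\phi](x)=\inf_{\lambda\in(0,1],\,b\in\mathbf{B}\setminus\{0\}}\frac{\phi(x+\lambda b)-\phi(x)-\langle D\phi(x),\lambda b\rangle}{|b|^2},\qquad M^+[\phi](x)=\sup_{\lambda\in(0,1],\,b\in\mathbf{B}\setminus\{0\}}\frac{\phi(x+\lambda b)-\phi(x)-\langle D\phi(x),\lambda b\rangle}{|b|^2}.$$ Viscosity solutions: a continuous map $u:\mathbb{R}^N\times[0,T]\to\mathbb{R}$ is a subsolution (resp. supersolution) of $u_t+F(x,t,Du,[u])=0$ in $\mathbb{R}^N\times(0,T)$ if, for any continuous bounded test function $\phi:\mathbb{R}^N\times(0,T)\to\mathbb{R}$ with continuous second order derivatives such that $u-\phi$ has a global maximum (resp. global minimum) at a point $(\bar x,\bar t)$, one has $\phi_t(\bar x,\bar t)+F(\bar x,\bar t,D\phi(\bar x,\bar t),[\phi(\cdot,\bar t)])\le 0$ (resp. $\ge 0$). For the two equations in the claim, $F(x,t,\xi,[\phi])$ is respectively $-\delta M^-[\phi](x)+\delta|\xi|^q+\delta$ and $-\delta M^+[\phi](x)+\frac1\delta|\xi|^q-\delta$. *)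

(* Defs.v *)
From HB Require Import structures.
From mathcomp Require Import all_boot all_order all_algebra.
From mathcomp Require Import all_classical all_reals all_analysis.
Import Order.TTheory GRing.Theory Num.Theory.
Import numFieldNormedType.Exports.

Set Implicit Arguments.
Unset Strict Implicit.
Unset Printing Implicit Defensive.

Local Open Scope classical_set_scope.
Local Open Scope ring_scope.

Definition dotv (R : realType) (N : nat) (x y : 'rV[R]_N) : R :=
  \sum_(i < N) x 0 i * y 0 i.

(* The norm `|x| of the library on 'rV[R]_N is the sup norm; the Euclidean norm
   is needed here. Both induce the same topology. *)
Definition enorm (R : realType) (N : nat) (x : 'rV[R]_N) : R :=
  Num.sqrt (dotv x x).

Definition grad (R : realType) (N : nat) (f : 'rV[R]_N -> R) (x : 'rV[R]_N) :
    'rV[R]_N :=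
  \row_(i < N) 'D_(delta_mx 0 i) f x.

Definition punctured_unit_ball (R : realType) (N : nat) : set 'rV[R]_N :=
  [set b | enorm b <= 1] `\ 0.

Definition increment_quotient (R : realType) (N : nat) (f : 'rV[R]_N -> R)
    (x : 'rV[R]_N) (lam : R) (b : 'rV[R]_N) : R :=
  (f (x + lam *: b) - f x - dotv (grad f x) (lam *: b)) / enorm b ^+ 2.

(* For N > 0 and f of class C^2, the set below is nonempty and bounded (Taylor
   on the compact unit ball around x), so the real-valued inf and sup are the
   usual ones. *)
Definition increment_quotients (R : realType) (N : nat) (f : 'rV[R]_N -> R)
    (x : 'rV[R]_N) : set R :=
  [set increment_quotient f x lb.1 lb.2 |
     lb in `]0, 1] `*` @punctured_unit_ball R N].

Definition Mminus (R : realType) (N : nat) (f : 'rV[R]_N -> R)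
    (x : 'rV[R]_N) : R :=
  inf (increment_quotients f x).

Definition Mplus (R : realType) (N : nat) (f : 'rV[R]_N -> R)
    (x : 'rV[R]_N) : R :=
  sup (increment_quotients f x).

(* Functions on a subset of R^N x R are represented by total functions whose
   values outside the subset are irrelevant. On an open set Omega the
   directional derivatives only depend on the values in Omega. *)
Definition C2_on (R : realType) (V : normedModType R) (Omega : set V)
    (f : V -> R) : Prop :=
  [/\ forall z, Omega z -> {for z, continuous f},
      forall v z, Omega z -> derivable f z v /\ {for z, continuous ('D_v f)} &
      forall v w z, Omega z ->
        derivable ('D_v f) z w /\ {for z, continuous ('D_w ('D_v f))}].

Definition open_slab (R : realType) (N : nat) (T : R) : set ('rV[R]_N * R) :=
  [set: 'rV[R]_N] `*` `]0, T[.

Definition closed_slab (R : realType) (N : nat) (T : R) : set ('rV[R]_N * R) :=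
  [set: 'rV[R]_N] `*` `[0, T].

Definition test_function (R : realType) (N : nat) (T : R)
    (phi : 'rV[R]_N * R -> R) : Prop :=
  C2_on (@open_slab R N T) phi /\
  exists K : R, forall z, open_slab T z -> `|phi z| <= K.

(* F x t xi f stands for F(x, t, xi, [f]). *)
Definition hamiltonian (R : realType) (N : nat) : Type :=
  'rV[R]_N -> R -> 'rV[R]_N -> ('rV[R]_N -> R) -> R.

Definition equation_lhs (R : realType) (N : nat) (F : hamiltonian R N)
    (phi : 'rV[R]_N * R -> R) (x : 'rV[R]_N) (t : R) : R :=
  derive1 (fun s : R => phi (x, s)) t +
  F x t (grad (fun y => phi (y, t)) x) (fun y => phi (y, t)).

Definition viscosity_subsolution (R : realType) (N : nat) (F : hamiltonian R N)
    (T : R) (u : 'rV[R]_N * R -> R) : Prop :=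
  {within closed_slab T, continuous u} /\
  forall phi : 'rV[R]_N * R -> R, test_function T phi ->
  forall (x : 'rV[R]_N) (t : R), open_slab T (x, t) ->
    (forall z, open_slab T z -> u z - phi z <= u (x, t) - phi (x, t)) ->
    equation_lhs F phi x t <= 0.

Definition viscosity_supersolution (R : realType) (N : nat)
    (F : hamiltonian R N) (T : R) (u : 'rV[R]_N * R -> R) : Prop :=
  {within closed_slab T, continuous u} /\
  forall phi : 'rV[R]_N * R -> R, test_function T phi ->
  forall (x : 'rV[R]_N) (t : R), open_slab T (x, t) ->
    (forall z, open_slab T z -> u (x, t) - phi (x, t) <= u z - phi z) ->
    0 <= equation_lhs F phi x t.

Definition F_super (R : realType) (N : nat) (q delta : R) : hamiltonian R N :=
  fun x _ xi f => - delta * Mminus f x + delta * enorm xi `^ q + delta.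

Definition F_sub (R : realType) (N : nat) (q delta : R) : hamiltonian R N :=
  fun x _ xi f => - delta * Mplus f x + delta^-1 * enorm xi `^ q - delta.

(* Main.v *)
Require Import Defs.
From HB Require Import structures.
From mathcomp Require Import all_boot all_order all_algebra.
From mathcomp Require Import all_classical all_reals all_analysis.
From mathcomp Require Import ring lra.
Import Order.TTheory GRing.Theory Num.Theory.
Import numFieldNormedType.Exports.

Local Open Scope classical_set_scope.
Local Open Scope ring_scope.

(** A subsolution started below m at one point lies below a barrier of Lax type
    m + C (|x - y|^2 + s)^(p/2) s^(1-p) + C' s^(1-p/2) + 2 delta s,
    with s the elapsed time: shifting |x - y|^2 by s smooths the vertex, concavity
    of the power p/2 bounds M^+ by a multiple of s^(-p/2), and this is integrable
    in time because q > 2, that is, p < 2.  A supersolution lying above a concave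
    paraboloid stays above it up to a loss linear in time.
    In the cylinders |x - x0| <= r, t0 - K^(1-q) r^kappa <= t < t0, with
    kappa = alpha + (1 - alpha) q, these two facts give a dichotomy: either u is
    small somewhere near x0 at the bottom and the first one lowers its maximum, or
    it is not and the second one raises its minimum.  Since kappa >= 2 for small
    alpha, the second order terms are absorbed by taking K large.  Iterating, the
    oscillation in the cylinder of radius r is at most K r^alpha, which is the
    claim for theta = (p - alpha) / (1 - alpha), as then
    alpha = (theta - p) / (theta - 1) and alpha / kappa = (theta - p) / theta. *)

Set Implicit Arguments.
Unset Strict Implicit.

Tactic Notation "lra_from" hyp_list(Hs) := clear - Hs; lra.

(** * Functions of class C^2 *)

(** The window comes from scaling. An oscillation K r^alpha over distance r means slopes K
    r^(alpha-1), and the gradient term produces that oscillation in time K r^alpha / (K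
    r^(alpha-1))^q = K^(1-q) r^kappa. Gradient terms are thus scale invariant and a large K does not
    help against them; in the supersolution step they are made small by a flat paraboloid, whose
    height is a small fraction eta of the oscillation. K absorbs the second and zeroth order terms.
    M^- and M^+ see increments up to distance 1, so a barrier must be ordered with u in the whole
    space, not only around a small cylinder. Hence the induction carries the oscillation bound on
    all larger cylinders, and alpha is small enough for the paraboloid to outgrow K X^alpha. The
    operators are used only through one-sided global quadratic bounds on the barrier. The exponent
    depends neither on tau nor on M. These enter through K: K >= 1/tau keeps the cylinders of radius
    at most 1 in nonnegative times, and K >= 4 M starts the induction. *)

Lemma is_derive_line (R : realType) (V W : normedModType R) (f : V -> W)
    (z v : V) (d : W) :
  is_derive z v f d <-> is_derive (0 : R) 1 (fun h : R => f (h *: v + z)) d.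
Proof.
have E : 'D_1 (fun h : R => f (h *: v + z)) 0 = 'D_v f z.
  rewrite /derive; set g1 := fun h => h^-1 *: _; set g2 := fun h => h^-1 *: _.
  suff -> : g1 = g2 by [].
  by rewrite funeqE /g1 /g2 => h /=; rewrite addr0 scale0r add0r [_%:A]mulr1.
split=> -[df <-]; split=> //.
  exact: (derivable1P f z v).1.
exact: (derivable1P f z v).2.
Qed.

Lemma is_derive_comp (R : realType) (V : normedModType R) (g : R -> R)
    (f : V -> R) (z v : V) (a b : R) :
  is_derive z v f a -> is_derive (f z) 1 g b -> is_derive z v (g \o f) (b * a).
Proof.
move=> /is_derive_line fa gb; apply/is_derive_line.
have gb' : is_derive ((fun h : R => f (h *: v + z)) 0) 1 g b.
  by rewrite scale0r add0r.

exact: (is_derive1_comp gb' fa).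
Qed.

Definition C1_on (R : realType) (V : normedModType R) (Om : set V)
    (f : V -> R) : Prop :=
  (forall z, Om z -> {for z, continuous f}) /\
  forall v z, Om z -> derivable f z v /\ {for z, continuous ('D_v f)}.

Section C2.
Variables (R : realType) (V : normedModType R).
Implicit Types (Om : set V) (f g : V -> R).

(** With [C2_on] split into two layers of [C1_on], its closure properties follow from the first
    order ones applied to an explicit formula for the directional derivative. *)
Lemma C2_onP Om f :
  C2_on Om f <-> C1_on Om f /\ forall v, C1_on Om ('D_v f).
Proof.
split=> [[cf df ddf]|[[cf df] H]].
  split=> [|v]; first by [].
  by split=> [z /(df v)[]|w z /(ddf v w)].
split=> [|v z Oz|v w z Oz]; [exact: cf|exact: df|exact: (H v).2].
Qed.

Lemma C1_on_eq Om f g : open Om -> (forall z, Om z -> f z = g z) ->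
  C1_on Om f -> C1_on Om g /\ forall v z, Om z -> 'D_v f z = 'D_v g z.
Proof.
move=> oO fg [cf df].
have nfg z : Om z -> {near z, f =1 g}.
  by move=> Oz; near=> y; apply: fg; near: y; exact: open_nbhs_nbhs.
have D v z : Om z -> is_derive z v g ('D_v f z).
  move=> Oz; apply: near_eq_is_derive (nfg z Oz) _.
  by apply: derivableP; exact: (df v z Oz).1.
have E v z : Om z -> 'D_v f z = 'D_v g z by move=> /(D v)[_ ->].
have ccl (h k : V -> R) z : Om z -> (forall z, Om z -> h z = k z) ->
    {for z, continuous h} -> {for z, continuous k}.
  move=> Oz hk ch; have ch' : h @ z --> h z by exact: ch.
  rewrite /prop_for /continuous_at -hk//; apply: cvg_trans ch'.
  apply: near_eq_cvg; near=> y; apply: hk.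
  by near: y; exact: open_nbhs_nbhs.
split; last exact: E.
split=> [z Oz|v z Oz].
  exact: ccl (cf z Oz).
split; first by case: (D v z Oz).
by apply: (ccl _ _ z Oz (E v)); exact: (df v z Oz).2.
Unshelve. all: by end_near. Qed.

Lemma C2_on_eq Om f g : open Om -> (forall z, Om z -> f z = g z) ->
  C2_on Om f -> C2_on Om g.
Proof.
move=> oO fg /C2_onP[f1 f2]; have [g1 E] := C1_on_eq oO fg f1.
apply/C2_onP; split=> [|v]; first exact: g1.
exact: (C1_on_eq oO (E v) (f2 v)).1.
Qed.

Lemma C1_onW Om Om' f : Om' `<=` Om -> C1_on Om f -> C1_on Om' f.
Proof. by move=> sO [cf df]; split=> [z /sO/cf|v z /sO/df]. Qed.

Lemma C2_onW Om Om' f : Om' `<=` Om -> C2_on Om f -> C2_on Om' f.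
Proof.
move=> sO /C2_onP[f1 f2]; apply/C2_onP; split=> [|v].
  exact: C1_onW sO f1.
exact: C1_onW sO (f2 v).
Qed.

(** All conditions are pointwise and concern the same total function, so nothing has to be glued. *)
Lemma C2_onU Om Om' f : C2_on Om f -> C2_on Om' f -> C2_on (Om `|` Om') f.
Proof.
move=> [a1 a2 a3] [b1 b2 b3]; split=> [z|v z|v w z] [].
- exact: a1.
- exact: b1.
- exact: a2.
- exact: b2.
- exact: a3.
- exact: b3.
Qed.

Lemma C1_on_cst Om (k : R) : C1_on Om (fun=> k).
Proof.
split=> [z _|v z _]; first exact: cvg_cst.
split; first exact: derivable_cst.
rewrite (_ : 'D_v _ = fun=> 0); first exact: cvg_cst.
by apply/funext => y; rewrite derive_cst.
Qed.

Lemma C2_on_cst Om (k : R) : C2_on Om (fun=> k).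
Proof.
apply/C2_onP; split=> [|v]; first exact: C1_on_cst.
rewrite (_ : 'D_v _ = fun=> 0); first exact: C1_on_cst.
by apply/funext => y; rewrite derive_cst.
Qed.

Lemma C1_on_derive Om f df : open Om ->
  (forall z, Om z -> {for z, continuous f}) ->
  (forall v z, Om z -> is_derive z v f (df v z)) ->
  (forall v z, Om z -> {for z, continuous (df v)}) -> C1_on Om f.
Proof.
move=> oO cf fd cd; split=> [|v z Oz]; first exact: cf.
split; first by case: (fd v z Oz).
have E y : Om y -> 'D_v f y = df v y by move=> /(fd v y)[].
have cd' : df v @ z --> df v z by exact: cd.
rewrite /prop_for /continuous_at E//; apply: cvg_trans cd'.
apply: near_eq_cvg; near=> y; rewrite E//.
by near: y; exact: open_nbhs_nbhs.
Unshelve. all: by end_near. Qed.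

Lemma C2_on_derive Om f df : open Om -> C1_on Om f ->
  (forall v z, Om z -> is_derive z v f (df v z)) ->
  (forall v, C1_on Om (df v)) -> C2_on Om f.
Proof.
move=> oO f1 fd cd; apply/C2_onP; split=> [|v]; first exact: f1.
apply: (C1_on_eq oO _ (cd v)).1 => z Oz.
by case: (fd v z Oz).
Qed.

Lemma C1_onD Om f g : open Om -> C1_on Om f -> C1_on Om g -> C1_on Om (f + g).
Proof.
move=> oO [cf df] [cg dg].
apply: (C1_on_derive (df := fun v => 'D_v f + 'D_v g) oO) => [z Oz|v z Oz|v z Oz].
- exact: cvgD (cf z Oz) (cg z Oz).
- exact: is_deriveD (derivableP (df v z Oz).1) (derivableP (dg v z Oz).1).
- exact: cvgD (df v z Oz).2 (dg v z Oz).2.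
Qed.

Lemma C1_onM Om f g : open Om -> C1_on Om f -> C1_on Om g -> C1_on Om (f * g).
Proof.
move=> oO [cf df] [cg dg].
apply: (C1_on_derive (df := fun v => f * 'D_v g + g * 'D_v f) oO)
  => [z Oz|v z Oz|v z Oz].
- exact: cvgM (cf z Oz) (cg z Oz).
- exact: is_deriveM (derivableP (df v z Oz).1) (derivableP (dg v z Oz).1).
- exact: cvgD (cvgM (cf z Oz) (dg v z Oz).2) (cvgM (cg z Oz) (df v z Oz).2).
Qed.

Lemma C2_onD Om f g : open Om -> C2_on Om f -> C2_on Om g -> C2_on Om (f + g).
Proof.
move=> oO /C2_onP[f1 f2] /C2_onP[g1 g2].
apply: (C2_on_derive (df := fun v => 'D_v f + 'D_v g) oO) => [|v z Oz|v].
- exact: C1_onD oO f1 g1.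
- exact: is_deriveD (derivableP (f1.2 v z Oz).1) (derivableP (g1.2 v z Oz).1).
- exact: C1_onD oO (f2 v) (g2 v).
Qed.

Lemma C2_onM Om f g : open Om -> C2_on Om f -> C2_on Om g -> C2_on Om (f * g).
Proof.
move=> oO /C2_onP[f1 f2] /C2_onP[g1 g2].
apply: (C2_on_derive (df := fun v => f * 'D_v g + g * 'D_v f) oO) => [|v z Oz|v].
- exact: C1_onM oO f1 g1.
- exact: is_deriveM (derivableP (f1.2 v z Oz).1) (derivableP (g1.2 v z Oz).1).
- exact: C1_onD oO (C1_onM oO f1 (g2 v)) (C1_onM oO g1 (f2 v)).
Qed.

Lemma C2_onN Om f : open Om -> C2_on Om f -> C2_on Om (- f).
Proof.
move=> oO f2; have -> : - f = (fun=> -1) * f.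
  by apply/funext => z; rewrite [RHS]mulN1r.
exact: C2_onM oO (C2_on_cst Om (-1)) f2.
Qed.

Lemma C1_on_comp Om (P : set R) (h h1 : R -> R) f : open Om ->
  (forall s, P s -> is_derive s 1 h (h1 s)) ->
  (forall s, P s -> {for s, continuous h1}) ->
  (forall z, Om z -> P (f z)) -> C1_on Om f -> C1_on Om (h \o f).
Proof.
move=> oO dh ch1 fP [cf df].
have ch s : P s -> {for s, continuous h}.
  move=> /dh[hs _]; apply: differentiable_continuous.
  exact/derivable1_diffP.
apply: (C1_on_derive (df := fun v => (h1 \o f) * 'D_v f) oO)
  => [z Oz|v z Oz|v z Oz].
- by apply: continuous_comp; [exact: cf|apply: ch; exact: fP].
- apply: is_derive_comp; last exact/dh/fP.
  by apply: derivableP; case: (df v z Oz).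
- apply: cvgM; last exact: (df v z Oz).2.
  by apply: continuous_comp; [exact: cf|apply: ch1; exact: fP].
Qed.

Lemma C2_on_comp Om (P : set R) (h h1 h2 : R -> R) f : open Om ->
  (forall s, P s -> is_derive s 1 h (h1 s)) ->
  (forall s, P s -> is_derive s 1 h1 (h2 s)) ->
  (forall s, P s -> {for s, continuous h2}) ->
  (forall z, Om z -> P (f z)) -> C2_on Om f -> C2_on Om (h \o f).
Proof.
move=> oO dh dh1 ch2 fP /C2_onP[f1 f2].
have ch1 s : P s -> {for s, continuous h1}.
  move=> /dh1[hs _]; apply: differentiable_continuous.
  exact/derivable1_diffP.
apply: (C2_on_derive (df := fun v => (h1 \o f) * 'D_v f) oO) => [|v z Oz|v].
- exact: (C1_on_comp oO dh ch1 fP f1).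
- apply: is_derive_comp; last exact/dh/fP.
  by apply: derivableP; case: (f1.2 v z Oz).
- exact: C1_onM oO (C1_on_comp oO dh1 ch2 fP f1) (f2 v).
Qed.

Lemma C2_on_lin Om f (l : V -> R) : open Om -> continuous f ->
  (forall v z, is_derive z v f (l v)) -> C2_on Om f.
Proof.
move=> oO cf fd.
have f1 : C1_on Om f.
  apply: (C1_on_derive (df := fun v => fun=> l v) oO) => [z _|v z _].
    exact: cf.
  exact: cvg_cst.
apply: (C2_on_derive (df := fun v => fun=> l v) oO f1) => v.
exact: (C1_on_cst Om (l v)).
Qed.

Lemma C2_on_sum Om (I : finType) (F : I -> V -> R) : open Om ->
  (forall i, C2_on Om (F i)) -> C2_on Om (fun z => \sum_i F i z).
Proof.
move=> oO FC; have -> : (fun z => \sum_i F i z) = \sum_i F i.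
  by apply/funext => z; rewrite fct_sumE.
apply: (big_ind (C2_on Om)) => [|f g f2 g2|i _].
- exact: (C2_on_cst Om 0).
- exact: C2_onD oO f2 g2.
- exact: FC.
Qed.

End C2.

(** * Positive parts, real powers and linear maps *)

Section ConcreteC2.
Variable R : realType.

(** Reads derivatives of piecewise functions off an algebraic bound, without one-sided limits at the
    junction; B = 0 covers affine functions. *)
Lemma is_derive_quadratic_error (f : R -> R) (s d B : R) :
  (forall h, `|h| <= 1 -> `|f (h + s) - f s - h * d| <= B * h ^+ 2) ->
  is_derive s 1 f d.
Proof.
move=> fB.
have B0 : 0 <= B.
  by have := fB 1; rewrite normr1 expr1n mulr1 => /(_ (lexx _)); apply: le_trans.
have lim_f : h^-1 *: ((f \o shift s) h%:A - f s) @[h --> 0^'] --> d.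
  apply/cvgrPdist_le => e e0; near=> h.
  have h0 : h != 0 by near: h; exact: nbhs_dnbhs_neq.
  have h1 : `|h| <= Num.min 1 (e / (B + 1)).
    near: h; apply: dnbhs0_le; rewrite lt_min ltr01 divr_gt0// ltr_wpDl//.
  move: h1; rewrite le_min => /andP[h1 h2] /=.
  rewrite [_%:A]mulr1 distrC /GRing.scale/=.
  have -> : h^-1 * (f (h + s) - f s) - d = h^-1 * (f (h + s) - f s - h * d).
    by rewrite [in RHS]mulrBr mulKf.
  rewrite normrM normfV ler_pdivrMl ?normr_gt0//.
  apply: le_trans (fB h h1) _.
  rewrite -[h ^+ 2]real_normK ?num_real// expr2 mulrCA ler_wpM2l//.
  apply: le_trans (_ : (B + 1) * `|h| <= _).
    by rewrite ler_wpM2r// lerDl.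
  by rewrite -ler_pdivlMl ?ltr_wpDl// mulrC.
split; first by apply/cvg_ex; exists d.
exact: cvg_lim lim_f.
Unshelve. all: by end_near. Qed.

Definition pospart (s : R) : R := Num.max 0 s.

Lemma pospartP (s : R) : (0 <= s /\ pospart s = s) \/ (s <= 0 /\ pospart s = 0).
Proof.
rewrite /pospart; case: (leP 0 s) => [s0|/ltW s0]; [left|right]; split=> //.
Qed.

Lemma is_derive_pospart2 (s : R) :
  is_derive s 1 (fun s => pospart s ^+ 2) (2 * pospart s).
Proof.
apply: (@is_derive_quadratic_error _ _ _ 1) => h _; rewrite ler_norml.
by case: (pospartP (h + s)) => -[? ->]; case: (pospartP s) => -[? ->];
  apply/andP; split; nra.
Qed.

Lemma is_derive_pospart3 (s : R) :
  is_derive s 1 (fun s => pospart s ^+ 3) (3 * pospart s ^+ 2).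
Proof.
(* Where both points are nonnegative the error is 3 s h^2 + h^3, and |h| <= 1. *)
apply: (@is_derive_quadratic_error _ _ _ (3 * `|s| + 1)) => h.
rewrite !ler_norml => /andP[h1 h2].
have hs1 := ler_norm s; have := ler_norm (- s); rewrite normrN => hs2.
have h0 := sqr_ge0 h.
have hh : 0 <= h ^+ 2 * (1 - h) by apply: mulr_ge0 => //; lra.
have hh' : 0 <= h ^+ 2 * (1 + h) by apply: mulr_ge0 => //; lra.
have ha : 0 <= h ^+ 2 * (`|s| - s) by apply: mulr_ge0 => //; lra.
have ha' : 0 <= h ^+ 2 * (`|s| + s) by apply: mulr_ge0 => //; lra.
case: (pospartP (h + s)) => -[H ->]; case: (pospartP s) => -[K ->].
- by apply/andP; split; nra.
- have : 0 <= (h + s) ^+ 3 by rewrite exprn_ge0.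
  have : (h + s) ^+ 3 <= h ^+ 3 by rewrite lerXn2r// ?nnegrE; lra.
  by move=> ? ?; apply/andP; split; nra.
- have sh : 0 <= s <= - h by lra.
  have : 0 <= s * (- h - s) by apply: mulr_ge0; lra.
  have : 0 <= s ^+ 2 * (- h - s) by apply: mulr_ge0; [exact: sqr_ge0|lra].
  have : 0 <= s * h ^+ 2 by apply: mulr_ge0 => //; lra.
  have : 0 <= s ^+ 3 by rewrite exprn_ge0.
  by move=> *; apply/andP; split; nra.
- by apply/andP; split; nra.
Qed.

Lemma continuous_pospart : continuous pospart.
Proof. by move=> s; apply: continuous_max; [exact: cvg_cst|exact: cvg_id]. Qed.

Variable V : normedModType R.
Implicit Types (Om : set V) (f g : V -> R).

Lemma C2_on_pospart3 Om f : open Om -> C2_on Om f ->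
  C2_on Om (fun z => pospart (f z) ^+ 3).
Proof.
move=> oO; apply: (C2_on_comp (P := setT) (h := fun s => pospart s ^+ 3)
  (h1 := fun s => 3 * pospart s ^+ 2) (h2 := fun s => 3 * (2 * pospart s)) oO).
- by move=> s _; exact: is_derive_pospart3.
- move=> s _; exact: (is_deriveZ 3 (is_derive_pospart2 s)).
- move=> s _; apply: cvgM; first exact: cvg_cst.
  by apply: cvgM; [exact: cvg_cst|exact: continuous_pospart].
- by [].
Qed.

Lemma C2_on_powR Om f a : open Om -> (forall z, Om z -> 0 < f z) ->
  C2_on Om f -> C2_on Om (fun z => f z `^ a).
Proof.
move=> oO f0 f2; have sub : forall z, Om z -> [set s | 0 < s] (f z) by [].
have d1 (s : R) : [set s : R | 0 < s] s -> is_derive s 1 (@powR R ^~ a) (a * s `^ (a - 1)).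
  exact: is_derive1_powR.
have d2 (s : R) : [set s : R | 0 < s] s ->
    is_derive s 1 (fun s => a * s `^ (a - 1)) (a * ((a - 1) * s `^ (a - 1 - 1))).
  by move=> s0; exact: (is_deriveZ a (is_derive1_powR (a - 1) s0)).
apply: (C2_on_comp oO d1 d2 _ sub f2) => s s0.
have c : {for s, continuous (@powR R ^~ (a - 1 - 1))}.
  apply: differentiable_continuous; apply/derivable1_diffP.
  by case: (is_derive1_powR (a - 1 - 1) s0).
exact: cvgM (cvg_cst _) (cvgM (cvg_cst _) c).
Qed.

Lemma is_derive_linear f (z v : V) :
  (forall h v z, f (h *: v + z) = h * f v + f z) -> is_derive z v f (f v).
Proof.
move=> fl; apply/is_derive_line.
rewrite (_ : (fun h => _) = (fun h => h * f v + f z)); last first.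
  by apply/funext => h; rewrite fl.
apply: (@is_derive_quadratic_error _ _ _ 0) => h _.
by rewrite addr0 mul0r add0r addrK subrr normr0 mul0r.
Qed.

End ConcreteC2.

(** * Test functions from local touching *)

Definition time_slab (R : realType) (N : nat) (a b : R) : set ('rV[R]_N * R) :=
  [set z | a < z.2 < b].

Section Slab.
Variables (R : realType) (N : nat).
Implicit Types (a b t T : R) (x y v : 'rV[R]_N).

Lemma open_slabE T : @open_slab R N T = @time_slab R N 0 T.
Proof.
apply/seteqP; split=> [z [_] /=|z /= Tz]; first by rewrite in_itv.
by split=> //=; rewrite in_itv.
Qed.

Lemma closed_slabP T (z : 'rV[R]_N * R) : closed_slab T z <-> 0 <= z.2 <= T.
Proof. by split=> [[_] /=|Tz]; [rewrite in_itv|split=> //=; rewrite in_itv]. Qed.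

Lemma open_time_slab a b : open (@time_slab R N a b).
Proof.
have -> : @time_slab R N a b = snd @^-1` [set t | a < t] `&` snd @^-1` [set t | t < b].
  by apply/seteqP; split=> z /= => [/andP[]|[? ?]]; [split|apply/andP].
apply: openI; apply: open_comp; try by move=> z _; exact: cvg_snd.
  exact: open_gt.
exact: open_lt.
Qed.

Lemma open_outside t r : open [set z : 'rV[R]_N * R | r < `|z.2 - t|].
Proof.
apply: (@open_comp _ _ (fun z : 'rV[R]_N * R => `|z.2 - t|) [set s | r < s]).
  move=> z _; apply: cvg_norm; apply: cvgB; [exact: cvg_snd|exact: cvg_cst].
exact: open_gt.
Qed.

Lemma C2_on_time (Om : set ('rV[R]_N * R)) : open Om -> C2_on Om snd.
Proof.
move=> oO; apply: (C2_on_lin (l := snd) oO) => [z|v z]; first exact: cvg_snd.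
by apply: is_derive_linear => h v' z'.
Qed.

Lemma C2_on_coord (Om : set ('rV[R]_N * R)) i : open Om ->
  C2_on Om (fun z => z.1 0 i).
Proof.
move=> oO; pose l (z : 'rV[R]_N * R) := z.1 0 i.
apply: (@C2_on_lin _ _ Om l l oO) => [z|v z].
  apply: (@continuous_comp _ _ _ fst (fun v : 'rV[R]_N => v 0 i)).
    exact: cvg_fst.
  exact: coord_continuous.
by apply: is_derive_linear => h v' z'; rewrite /l /= !mxE.
Qed.

Lemma C2_on_sqdist (Om : set ('rV[R]_N * R)) y : open Om ->
  C2_on Om (fun z => dotv (z.1 - y) (z.1 - y)).
Proof.
move=> oO; rewrite /dotv; apply: (C2_on_sum oO) => i.
have c1 : C2_on Om ((fun z : 'rV[R]_N * R => z.1 0 i) + (fun=> - y 0 i)).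
  exact: C2_onD oO (C2_on_coord i oO) (C2_on_cst Om _).
apply: (C2_on_eq oO _ (C2_onM oO c1 c1)) => z _ /=.
by rewrite !mxE.
Qed.

End Slab.

(** * Truncation in value and cutoff in time *)

Section Truncation.
Variables (R : realType) (L : R).

(* Above L this is L + w / (1 + w^2) with w = s - L; the cube makes it C^2 across L. *)
Definition trunc (s : R) : R := s - pospart (s - L) ^+ 3 / (1 + (s - L) ^+ 2).

Lemma trunc_id s : s <= L -> trunc s = s.
Proof.
rewrite /trunc => sL; case: (pospartP (s - L)) => -[h ->].
  have -> : s - L = 0 by lra.
  by rewrite expr0n mul0r subr0.
by rewrite expr0n mul0r subr0.
Qed.

Lemma trunc_bounds s : L <= s -> L <= trunc s <= L + 1.
Proof.
rewrite /trunc => sL; case: (pospartP (s - L)) => -[h ->]; last first.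
  by rewrite expr0n mul0r subr0; apply/andP; split; lra.
have d0 : 0 < 1 + (s - L) ^+ 2 by rewrite ltr_pwDl// sqr_ge0.
have -> : s - (s - L) ^+ 3 / (1 + (s - L) ^+ 2) =
    L + (s - L) / (1 + (s - L) ^+ 2) by field; apply: lt0r_neq0.
rewrite lerDl lerD2l divr_ge0 ?(ltW d0)//= ler_pdivrMr//.
by have := sqr_ge0 (s - L - 1); nra.
Qed.

Lemma trunc_le s : trunc s <= s.
Proof.
rewrite /trunc gerBl divr_ge0//; last by rewrite addr_ge0// sqr_ge0.
by rewrite exprn_ge0//; case: (pospartP (s - L)) => -[h ->].
Qed.

(** The endpoint s = L is included because the value of the test function at the contact point
    equals L when [w] attains its bound M there. *)
Lemma is_derive_trunc s : s <= L -> is_derive s 1 trunc 1.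
Proof.
move=> sL; apply: (@is_derive_quadratic_error _ _ _ _ 1) => h h1.
rewrite (trunc_id sL) mul1r mulr1 /trunc.
have d0 : 0 < 1 + (h + s - L) ^+ 2 by rewrite ltr_pwDl// sqr_ge0.
set e := _ / _; have -> : h + s - e - s - h = - e by ring.
rewrite normrN /e ger0_norm; last first.
  apply: divr_ge0; last exact: ltW.
  by rewrite exprn_ge0//; case: (pospartP (h + s - L)) => -[? ->].
rewrite ler_pdivrMr//; case: (pospartP (h + s - L)) => -[k ->]; last first.
  by rewrite expr0n/= mulr_ge0// ?sqr_ge0// ltW.
move: h1; rewrite ler_norml => /andP[h1 h2].
have hk : h + s - L <= h by lra.
have : (h + s - L) ^+ 3 <= h ^+ 3 by rewrite lerXn2r// ?nnegrE; lra.
have : h ^+ 3 <= h ^+ 2 by rewrite exprS ler_piMl// sqr_ge0.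
have : 0 <= h ^+ 2 * (h + s - L) ^+ 2 by rewrite mulr_ge0 ?sqr_ge0.
by rewrite mulrDr mulr1; lra.
Qed.

Lemma C2_on_trunc (V : normedModType R) (Om : set V) (f : V -> R) :
  open Om -> C2_on Om f -> C2_on Om (fun z => trunc (f z)).
Proof.
move=> oO f2.
have fL : C2_on Om (f + (fun=> - L)) := C2_onD oO f2 (C2_on_cst Om _).
have den : C2_on Om ((fun=> 1) + (f + (fun=> - L)) * (f + (fun=> - L))).
  exact: C2_onD oO (C2_on_cst Om _) (C2_onM oO fL fL).
have den0 z : Om z -> 0 < ((fun=> 1) + (f + (fun=> - L)) * (f + (fun=> - L))) z.
  by move=> _; rewrite ltr_pwDl// -expr2 sqr_ge0.
have := C2_onD oO f2 (C2_onN oO (C2_onM oO (C2_on_pospart3 oO fL)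
  (C2_on_powR (-1) oO den0 den))).
apply: (C2_on_eq oO) => z Oz /=; rewrite /trunc; congr (_ - _ * _).
by rewrite powR_inv1 ?ltW ?den0// expr2.
Qed.

End Truncation.

Section Cutoff.
Variables (R : realType) (t r : R).
Hypothesis r0 : 0 < r.

Definition cutoff (s : R) : R := pospart (1 - ((s - t) / r) ^+ 2) ^+ 3.

Lemma cutoff_bounds s : 0 <= cutoff s <= 1.
Proof.
rewrite /cutoff; have := sqr_ge0 ((s - t) / r); set w := _ ^+ 2 => w0.
case: (pospartP (1 - w)) => -[h ->]; last by rewrite expr0n/= lexx ler01.
by rewrite exprn_ge0//= exprn_ile1//; lra.
Qed.

Lemma cutoff_center : cutoff t = 1.
Proof.
rewrite /cutoff subrr mul0r expr0n subr0 /=.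
by case: (pospartP (1 : R)) => -[h ->]; [rewrite expr1n|lra].
Qed.

Lemma cutoff_outside s : r < `|s - t| -> cutoff s = 0.
Proof.
move=> rs; rewrite /cutoff; case: (pospartP (1 - ((s - t) / r) ^+ 2)) => -[h ->].
  have : 1 < ((s - t) / r) ^+ 2.
    rewrite -real_normK ?num_real// exprn_egt1// normrM normfV (gtr0_norm r0).
    by rewrite ltr_pdivlMr// mul1r.
  by lra.
by rewrite expr0n.
Qed.

(** Flatness at the centre ensures that multiplication by the cutoff leaves the time derivative at
    the contact point unchanged. *)
Lemma is_derive_cutoff : is_derive t 1 cutoff 0.
Proof.
(* The constant is that of 1 - (1 - w)^3 <= 3 w with w = (h / r)^2. *)
apply: (@is_derive_quadratic_error _ _ _ _ (3 / r ^+ 2)) => h _.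
rewrite cutoff_center mulr0 subr0 distrC ger0_norm; last first.
  by have /andP[_] := cutoff_bounds (h + t); lra.
rewrite /cutoff addrK expr_div_n [leRHS]mulrAC -[leRHS]mulrA.
have := divr_ge0 (sqr_ge0 h) (sqr_ge0 r); set w := h ^+ 2 / _ => w0.
case: (pospartP (1 - w)) => -[k ->]; last by rewrite expr0n /=; lra.
by nra.
Qed.

Lemma C2_on_cutoff N (Om : set ('rV[R]_N * R)) : open Om ->
  C2_on Om (fun z : 'rV[R]_N * R => cutoff z.2).
Proof.
move=> oO; pose l (z : 'rV[R]_N * R) := z.2.
have a : C2_on Om ((fun=> r^-1) * (l + (fun=> - t))).
  exact: C2_onM oO (C2_on_cst Om _) (C2_onD oO (C2_on_time oO) (C2_on_cst Om _)).
have := C2_on_pospart3 oO (C2_onD oO (C2_on_cst Om 1) (C2_onN oO (C2_onM oO a a))).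
apply: (C2_on_eq oO) => z _; rewrite /cutoff /l /=; congr (pospart (_ - _) ^+ 3).
have : r^-1 * (z.2 - t) * (r^-1 * (z.2 - t)) = ((z.2 - t) / r) ^+ 2.
  by rewrite expr2 [_ / r]mulrC.
exact.
Qed.

End Cutoff.

(* The witness is k trunc_L(phi) + (1 - k) L, with k a cutoff in time and L = M - c:
   as w - L <= c everywhere, the convex combination keeps the global maximum, and
   phi may be unbounded and need only be C^2 on a slab around t. *)
Lemma touching_test (R : realType) (N : nat) (T M a b : R)
    (w phi : 'rV[R]_N * R -> R) (x : 'rV[R]_N) (t : R) :
  0 <= a -> b <= T -> a < t < b ->
  (forall z, open_slab T z -> `|w z| <= M) ->
  C2_on (time_slab a b) phi ->
  (forall z, time_slab a b z -> w z - phi z <= w (x, t) - phi (x, t)) ->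
  exists psi : 'rV[R]_N * R -> R,
    [/\ test_function T psi,
        forall z, open_slab T z -> w z - psi z <= w (x, t) - psi (x, t),
        psi (x, t) = phi (x, t) /\ (forall y, psi (y, t) <= phi (y, t)),
        forall d, is_derive t 1 (fun s => phi (x, s)) d ->
          is_derive t 1 (fun s => psi (x, s)) d &
        forall v d, is_derive x v (fun y => phi (y, t)) d ->
          is_derive x v (fun y => psi (y, t)) d].
Proof.
move=> a0 bT /andP[at_ tb] wM phi2 phimax.
set c := w (x, t) - phi (x, t) in phimax *.
have wM' z : open_slab T z -> - M <= w z <= M by move=> /wM; rewrite ler_norml.
(* Half the distance from [t] to the ends of the interval: the cutoff vanishes before [phi] ceases
   to be C^2. *)
pose L := M - c; pose r := Num.min (t - a) (b - t) / 2.
have r0 : 0 < r by rewrite divr_gt0// lt_min !subr_gt0 at_ tb.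
have inab s : `|s - t| <= r -> a < s < b.
  rewrite ler_norml => /andP[s1 s2].
  have : r < t - a /\ r < b - t.
    by rewrite /r; case: (leP (t - a) (b - t)) => ?; split; lra.
  by move=> [? ?]; apply/andP; split; lra.
have abT s : a < s < b -> 0 < s < T by move=> /andP[? ?]; apply/andP; split; lra.
pose psi (z : 'rV[R]_N * R) := cutoff t r z.2 * trunc L (phi z) + (1 - cutoff t r z.2) * L.
have Oxt : open_slab T (x, t) by rewrite open_slabE; apply: abT; rewrite at_ tb.
have phixL : phi (x, t) <= L.
  by rewrite /L /c; have /andP[] := wM' _ Oxt; lra.
have psixt y : psi (y, t) = trunc L (phi (y, t)).
  by rewrite /psi /= cutoff_center subrr mul0r mul1r addr0.
have truncw z : time_slab a b z -> w z - trunc L (phi z) <= c.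
  move=> zab; have [h|/ltW h] := leP (phi z) L; first by rewrite trunc_id//; exact: phimax.
  have /andP[h1 _] := trunc_bounds h.
  have : open_slab T z by rewrite open_slabE; exact: abT.
  by move=> /wM' /andP[_]; rewrite /L in h1; lra.
have psiE z : psi z = cutoff t r z.2 * (trunc L (phi z) - L) + L by rewrite /psi; ring.
exists psi; split.
- split.
    (* Two open sets cover the slab: on the first [phi] is C^2, on the second the cutoff vanishes
       and [psi] is the constant L. *)
    have oI := @open_time_slab R N a b; have oO := @open_outside R N t r.
    have CI : C2_on (time_slab a b) psi.
      have cI := @C2_on_cutoff R t r N _ oI.
      have := C2_onD oI (C2_onM oI cI (C2_on_trunc L oI phi2))
        (C2_onM oI (C2_onD oI (C2_on_cst _ 1) (C2_onN oI cI)) (C2_on_cst _ L)).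
      by apply: (C2_on_eq oI) => z _.
    have CO : C2_on [set z : 'rV[R]_N * R | r < `|z.2 - t|] psi.
      apply: (C2_on_eq oO _ (C2_on_cst _ L)) => z rz.
      by rewrite psiE cutoff_outside// mul0r add0r.
    apply: (C2_onW _ (C2_onU CI CO)) => z _.
    by have [h|h] := leP `|z.2 - t| r; [left; exact: inab|right].
  exists (2 * M + 2 * `|c| + 1) => z Oz.
  have M0 : 0 <= M by apply: le_trans (wM _ Oz).
  have cc := ler_norm c; have cc' := ler_norm (- c); rewrite normrN in cc'.
  rewrite psiE; have [h|h] := ltP r `|z.2 - t|.
    by rewrite cutoff_outside// mul0r add0r /L ler_norml; apply/andP; split; lra.
  have /inab zab := h; have /andP[k0 k1] := cutoff_bounds t r z.2.
  have /andP[b1 b2] : - M - c <= trunc L (phi z) <= L + 1.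
    have := truncw z zab; have /andP[? ?] := wM' z Oz => ?.
    have [hL|/ltW hL] := leP (phi z) L; last first.
      by have /andP[? ?] := trunc_bounds hL; apply/andP; split; lra.
    by apply/andP; split; [lra|rewrite trunc_id; lra].
  have k2 : cutoff t r z.2 * (trunc L (phi z) - L) <= 1.
    apply: le_trans (_ : cutoff t r z.2 * 1 <= _); last by lra.
    by rewrite ler_wpM2l//; lra.
  have k3 : - (2 * M) <= cutoff t r z.2 * (trunc L (phi z) - L).
    apply: le_trans (_ : cutoff t r z.2 * (- (2 * M)) <= _); first by nra.
    by rewrite ler_wpM2l// /L; lra.
  have e1 : L = M - c by [].
  by rewrite ler_norml; apply/andP; split; lra.
- move=> z Oz; rewrite psixt trunc_id// -/c psiE.
  have [h|h] := ltP r `|z.2 - t|.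
    rewrite cutoff_outside// mul0r add0r /L; have /andP[] := wM' z Oz; lra.
  have /truncw zab := inab _ h; have /andP[k0 k1] := cutoff_bounds t r z.2.
  have /andP[_ wz] := wM' z Oz; move: zab.
  have e1 : L = M - c by [].
  set k := cutoff _ _ _ in k0 k1 *; set y := trunc _ _ => zab.
  have : 0 <= k * (c + y - w z) by rewrite mulr_ge0//; lra.
  have : 0 <= (1 - k) * (M - w z) by rewrite mulr_ge0//; lra.
  by rewrite e1; nra.
- by split=> [|y]; rewrite psixt; [rewrite trunc_id|exact: trunc_le].
- move=> d dphi.
  have dt : is_derive t 1 (trunc L \o (fun s => phi (x, s))) (1 * d).
    by apply: is_derive_comp dphi _; exact: is_derive_trunc.
  have dk := is_derive_cutoff t r.
  have := is_deriveD (is_deriveM dk (is_deriveB dt (is_derive_cst L t 1)))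
     (is_derive_cst L t 1).
  rewrite cutoff_center scaler0 addr0 addr0 subr0 mul1r scale1r.
  set f := (X in is_derive _ _ X _ -> _); suff -> : (fun s => psi (x, s)) = f by [].
  by apply/funext => s; rewrite psiE.
- move=> v d dphi.
  have := is_derive_comp dphi (is_derive_trunc phixL).
  rewrite mul1r; set f := (X in is_derive _ _ X _ -> _).
  suff -> : (fun y => psi (y, t)) = f by [].
  by apply/funext => y; rewrite psixt.
Qed.

(** * Viscosity inequalities at touching points *)

Section Euclidean.
Variables (R : realType) (N : nat).
Implicit Types (x y v : 'rV[R]_N) (k : R).

Lemma dotvv_ge0 x : 0 <= dotv x x.
Proof. by apply: sumr_ge0 => i _; rewrite -expr2 sqr_ge0. Qed.

Lemma enorm_ge0 x : 0 <= enorm x.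
Proof. exact: sqrtr_ge0. Qed.

Lemma enorm_sqr x : enorm x ^+ 2 = dotv x x.
Proof. by rewrite sqr_sqrtr// dotvv_ge0. Qed.

Lemma dotvC x y : dotv x y = dotv y x.
Proof. by apply: eq_bigr => i _; rewrite mulrC. Qed.

Lemma dotvDr x y v : dotv x (y + v) = dotv x y + dotv x v.
Proof. by rewrite -big_split; apply: eq_bigr => i _; rewrite mxE mulrDr. Qed.

Lemma dotvZr x y k : dotv x (k *: y) = k * dotv x y.
Proof. by rewrite [RHS]big_distrr; apply: eq_bigr => i _; rewrite mxE mulrCA. Qed.

Lemma dotvDl x y v : dotv (x + y) v = dotv x v + dotv y v.
Proof. by rewrite dotvC dotvDr !(dotvC v). Qed.

Lemma dotvZl x y k : dotv (k *: x) y = k * dotv x y.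
Proof. by rewrite dotvC dotvZr dotvC. Qed.

Lemma dotvNr x y : dotv x (- y) = - dotv x y.
Proof. by rewrite -scaleN1r dotvZr mulN1r. Qed.

Lemma dotv_delta x i : dotv x (delta_mx 0 i) = x 0 i.
Proof.
rewrite /dotv (bigD1 i)//= mxE !eqxx mulr1 big1 ?addr0// => j ji.
by rewrite mxE (negbTE ji) andbF mulr0.
Qed.

Lemma dotvvN x : dotv (- x) (- x) = dotv x x.
Proof. by apply: eq_bigr => i _; rewrite !mxE mulrNN. Qed.

Lemma enormN x : enorm (- x) = enorm x.
Proof. by rewrite /enorm dotvvN. Qed.

Lemma enormZ k x : enorm (k *: x) = `|k| * enorm x.
Proof. by rewrite /enorm dotvZr dotvZl mulrA -expr2 sqrtrM ?sqr_ge0// sqrtr_sqr. Qed.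

Lemma enorm_le k x : 0 <= k -> (enorm x <= k) = (dotv x x <= k ^+ 2).
Proof. by move=> k0; rewrite -enorm_sqr ler_sqr// nnegrE enorm_ge0. Qed.

Lemma dotvv_add_le x y : dotv (x + y) (x + y) <= 2 * dotv x x + 2 * dotv y y.
Proof.
have := dotvv_ge0 (x - y).
by rewrite !dotvDl !dotvDr dotvvN !dotvNr (dotvC y x) (dotvC (- y) x) dotvNr; lra.
Qed.

Lemma normr_le_enorm x : `|x| <= enorm x.
Proof.
rewrite [leLHS]mx_normrE; apply/bigmax_leP; split=> [|[i j] _ /=]; first exact: enorm_ge0.
rewrite (ord1 i) -sqrtr_sqr /enorm ler_sqrt ?dotvv_ge0//.
rewrite /dotv (bigD1 j)//= -expr2 lerDl.
by apply: sumr_ge0 => l _; rewrite -expr2 sqr_ge0.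
Qed.

Lemma enorm0_eq0 x : enorm x = 0 -> x = 0.
Proof.
by move=> x0; apply/eqP; rewrite -normr_eq0 eq_le normr_ge0 -x0 normr_le_enorm.
Qed.

Lemma grad_eq (f : 'rV[R]_N -> R) x g :
  (forall v, is_derive x v f (dotv g v)) -> grad f x = g.
Proof.
move=> fg; apply/rowP => i; rewrite mxE.
by case: (fg (delta_mx 0 i)) => _ ->; exact: dotv_delta.
Qed.

(** The increment along [lam *: b] is at most A lam^2 |b|^2, and lam <= 1. For b of norm 0 the
    quotient is 0 by the convention on division. *)
Lemma increment_quotient_le (f : 'rV[R]_N -> R) x A lam b : 0 <= A ->
  (forall y, f (x + y) - f x - dotv (grad f x) y <= A * dotv y y) ->
  0 < lam <= 1 -> increment_quotient f x lam b <= A.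
Proof.
move=> A0 fA /andP[l0 l1]; rewrite /increment_quotient enorm_sqr.
have [b0|b0] := eqVneq (dotv b b) 0; first by rewrite b0 invr0 mulr0.
have b1 : 0 < dotv b b by rewrite lt_neqAle eq_sym b0 dotvv_ge0.
rewrite ler_pdivrMr//; apply: le_trans (fA _) _.
rewrite ler_wpM2l// dotvZl dotvZr mulrA ler_piMl// ?dotvv_ge0//.
by rewrite mulr_ile1// ltW.
Qed.

Lemma Mplus_le (f : 'rV[R]_N -> R) x A : 0 <= A ->
  (forall y, f (x + y) - f x - dotv (grad f x) y <= A * dotv y y) ->
  Mplus f x <= A.
Proof.
move=> A0 fA; rewrite /Mplus; set E := increment_quotients f x.
(* The set is empty when N = 0; its [sup] is then 0 by default, and 0 <= A. *)
have [E0|/set0P/negP/negPn/eqP->] := pselect (E !=set0); last by rewrite sup0.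
apply: ge_sup => // _ [[lam b] [/= lamI _] <-].
by apply: increment_quotient_le => //; move: lamI; rewrite in_itv.
Qed.

Lemma Mminus_ge (f : 'rV[R]_N -> R) x A : 0 <= A ->
  (forall y, - (A * dotv y y) <= f (x + y) - f x - dotv (grad f x) y) ->
  - A <= Mminus f x.
Proof.
move=> A0 fA; rewrite /Mminus; set E := increment_quotients f x.
have [E0|/set0P/negP/negPn/eqP->] := pselect (E !=set0); last first.
  by rewrite inf0 oppr_le0.
apply: lb_le_inf => // _ [[lam b] [/= lamI _] <-].
move: lamI; rewrite in_itv /= => /andP[l0 l1].
rewrite /increment_quotient enorm_sqr.
have [b0|b0] := eqVneq (dotv b b) 0; first by rewrite b0 invr0 mulr0 oppr_le0.
have b1 : 0 < dotv b b by rewrite lt_neqAle eq_sym b0 dotvv_ge0.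
rewrite ler_pdivlMr//; apply: le_trans (fA _); rewrite mulNr lerN2.
rewrite ler_wpM2l// dotvZl dotvZr mulrA ler_piMl// ?dotvv_ge0//.
by rewrite mulr_ile1// ltW.
Qed.

End Euclidean.

(* Meant for w = u when u is a subsolution and w = - u when u is a supersolution;
   A then bounds the extremal operator, and H A |g| collects all the terms of the
   equation but the time derivative. *)
Definition touching_inequality (R : realType) (N : nat) (H : R -> R -> R) (T : R)
    (w : 'rV[R]_N * R -> R) : Prop :=
  forall (a b : R) (phi : 'rV[R]_N * R -> R) (x g : 'rV[R]_N) (t A ft : R),
    0 <= a -> b <= T -> a < t < b -> C2_on (time_slab a b) phi ->
    (forall z, time_slab a b z -> w z - phi z <= w (x, t) - phi (x, t)) ->
    is_derive t 1 (fun s => phi (x, s)) ft ->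
    (forall v, is_derive x v (fun y => phi (y, t)) (dotv g v)) ->
    0 <= A ->
    (forall y, phi (x + y, t) - phi (x, t) - dotv g y <= A * dotv y y) ->
    ft <= H A (enorm g).

Section Touching.
Variables (R : realType) (N : nat) (q delta T M : R) (u : 'rV[R]_N * R -> R).
Hypotheses (delta0 : 0 <= delta)
  (uM : forall z, closed_slab T z -> `|u z| <= M).

Let uM' z : open_slab T z -> `|u z| <= M.
Proof.
rewrite open_slabE => /andP[t0 tT]; apply/uM/closed_slabP.
by rewrite (ltW t0) (ltW tT).
Qed.

(** The bounded test function lies below [phi] at time t and agrees with it at x, so its increments,
    and with them M^+, inherit the quadratic bound on [phi]. *)
Lemma subsolution_touching : viscosity_subsolution (F_sub q delta) T u ->
  touching_inequality (fun A s => delta * A - delta^-1 * s `^ q + delta) T u.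
Proof.
move=> [_ usub] a b phi x g t A ft a0 bT tab phi2 phimax dt dx A0 phiA.
have [psi [psit psimax [psixt psile] psidt psidx]] :=
  touching_test a0 bT tab uM' phi2 phimax.
have Oxt : open_slab T (x, t).
  by rewrite open_slabE; case/andP: tab => ? ?; apply/andP; split=> /=; lra.
have := usub _ psit x t Oxt psimax.
have gE : grad (fun y => psi (y, t)) x = g.
  by apply: grad_eq => v; apply: psidx; exact: dx.
rewrite /equation_lhs /F_sub derive1E gE.
have [_ ->] := psidt _ dt.
have : Mplus (fun y => psi (y, t)) x <= A.
  apply: Mplus_le => // y; rewrite gE psixt; apply: le_trans (phiA y).
  by rewrite !lerD2r psile.
move=> /(ler_wpM2l delta0); lra.
Qed.

(** A maximum of - u - psi is a minimum of u - (- psi), and an upper quadratic bound on psi gives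
    M^- of [- psi] at least - A. *)
Lemma supersolution_touching : viscosity_supersolution (F_super q delta) T u ->
  touching_inequality (fun A s => delta * A + delta * s `^ q + delta) T (- u).
Proof.
move=> [_ usup] a b phi x g t A ft a0 bT tab phi2 phimax dt dx A0 phiA.
have uMN z : open_slab T z -> `|(- u) z| <= M by move=> /uM'; rewrite normrN.
have [psi [[psi2 [K psiK]] psimax [psixt psile] psidt psidx]] :=
  touching_test a0 bT tab uMN phi2 phimax.
have Oxt : open_slab T (x, t).
  by rewrite open_slabE; case/andP: tab => ? ?; apply/andP; split=> /=; lra.
have psit : test_function T (- psi).
  split; first by apply: C2_onN => //; rewrite open_slabE; exact: open_time_slab.
  by exists K => z Oz; rewrite normrN psiK.
have psimin z : open_slab T z -> u (x, t) - (- psi) (x, t) <= u z - (- psi) z.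
  move=> /psimax; have EN (f : 'rV[R]_N * R -> R) y : (- f) y = - f y by [].
  by rewrite !EN; lra.
have := usup _ psit x t Oxt psimin.
have gE : grad (fun y => (- psi) (y, t)) x = - g.
  apply: grad_eq => v; rewrite dotvC dotvNr dotvC.
  by apply: is_deriveN; apply: psidx; exact: dx.
rewrite /equation_lhs /F_super derive1E gE enormN.
have [_ ->] := is_deriveN (psidt _ dt).
have : - A <= Mminus (fun y => (- psi) (y, t)) x.
  apply: Mminus_ge => // y; rewrite gE dotvC dotvNr dotvC.
  have EN z : (- psi) z = - psi z by [].
  by rewrite !EN psixt; have := phiA y; have := psile (x + y); lra.
move=> /(ler_wpM2l delta0); lra.
Qed.

End Touching.

(** * Comparison with smooth barriers *)

Lemma continuous_dist (R : realType) (V : normedModType R) (y : V) :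
  continuous (fun x : V => `|x - y|).
Proof.
by move=> x; apply: cvg_norm; apply: cvgB; [exact: cvg_id|exact: cvg_cst].
Qed.

Lemma compact_cylinder (R : realType) (N : nat) (y : 'rV[R]_N) (r a b : R) :
  compact [set z : 'rV[R]_N * R | `|z.1 - y| <= r /\ a <= z.2 <= b].
Proof.
have -> : [set z : 'rV[R]_N * R | `|z.1 - y| <= r /\ a <= z.2 <= b] =
    [set x | `|x - y| <= r] `*` `[a, b].
  by apply/seteqP; split=> z /= []; rewrite in_itv.
apply: compact_setX; last exact: segment_compact.
apply: bounded_closed_compact.
  exists (r + `|y|); split; first exact: num_real.
  move=> k rk x /= xr; rewrite -[x](subrK y); apply: le_trans (ler_normD _ _) _.
  by apply: ltW; apply: le_lt_trans rk; rewrite lerD2r.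
have cf : continuous (fun x : 'rV[R]_N => `|x - y|).
  exact: (@continuous_dist R 'rV[R]_N).
have cr : closed [set s : R | s <= r] by exact: closed_le.
exact: preimage_closed (fun x _ => cf x) cr.
Qed.

(** At a positive maximum of w - phi - pen the touching inequality gives ft + pen' <= H A |g| <= ft,
    although pen' > 0. The penalization thus supplies the strictness, and the barrier has to satisfy
    its inequality only where it is crossed. Since w <= phi outside a ball, a maximum over a compact
    cylinder is global. *)
Lemma comparison (R : realType) (N : nat) (H : R -> R -> R)
    (T M B s0 b r : R) (y : 'rV[R]_N) (w phi : 'rV[R]_N * R -> R) :
  0 <= s0 -> b <= T -> touching_inequality H T w ->
  {within closed_slab T, continuous w} ->
  (forall z, closed_slab T z -> `|w z| <= M) ->
  C2_on (time_slab s0 b) phi ->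
  (forall z : 'rV[R]_N * R, s0 <= z.2 < b -> {for z, continuous phi}) ->
  (forall z : 'rV[R]_N * R, s0 <= z.2 < b -> - B <= phi z) ->
  (forall x, w (x, s0) <= phi (x, s0)) ->
  (forall x t, s0 <= t < b -> r < enorm (x - y) -> w (x, t) <= phi (x, t)) ->
  (forall x t, s0 < t < b -> phi (x, t) < w (x, t) ->
    exists A g ft, [/\ 0 <= A, is_derive t 1 (fun s => phi (x, s)) ft,
      forall v, is_derive x v (fun y => phi (y, t)) (dotv g v),
      forall y, phi (x + y, t) - phi (x, t) - dotv g y <= A * dotv y y &
      H A (enorm g) <= ft]) ->
  forall x t, s0 <= t < b -> w (x, t) <= phi (x, t).
Proof.
move=> s00 bT wH cw wM phi2 cphi phiB init far strict x1 t1 /andP[st1 tb1].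
rewrite leNgt; apply/negP => phiw1.
set c := w (x1, t1) - phi (x1, t1); have c0 : 0 < c by rewrite subr_gt0.
(* The penalization gam / (b - t) keeps the maximum away from the final time b. *)
pose gam := c * (b - t1) / 2.
have bt1 : 0 < b - t1 by lra.
have gam0 : 0 < gam by rewrite divr_gt0// mulr_gt0.
pose pen (s : R) := gam * (b - s) `^ (-1).
have penE s : s < b -> pen s = gam / (b - s).
  by move=> sb; rewrite /pen powR_inv1//; lra.
pose psi := phi + (fun z => pen z.2).
have psiE z : psi z = phi z + pen z.2 by [].
have clT (z : 'rV[R]_N * R) : s0 <= z.2 < b -> closed_slab T z.
  by move=> /andP[? ?]; apply/closed_slabP/andP; split=> /=; lra.
have M0 : 0 <= M by apply: le_trans (wM (x1, t1) _) => //; apply: clT; apply/andP.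
(* Within e of the time b the penalization is at least M + |B| + 1, so w - psi is negative there;
   moreover t1 <= b - e. *)
pose e := Num.min (gam / (M + `|B| + 1)) (b - t1).
have D0 : 0 < M + `|B| + 1 by rewrite ltr_wpDl// addr_ge0.
have e0 : 0 < e by rewrite lt_min bt1 divr_gt0.
have [e1 e2] : e <= gam / (M + `|B| + 1) /\ e <= b - t1.
  by split; rewrite /e ge_min lexx ?orbT.
pose K := [set z : 'rV[R]_N * R | `|z.1 - y| <= r /\ s0 <= z.2 <= b - e].
have Kx1 : K (x1, t1).
  split=> /=; last by apply/andP; split; lra.
  rewrite leNgt; apply/negP => rx; move: phiw1; rewrite ltNge => /negP; apply.
  apply: far; first by apply/andP.
  exact: lt_le_trans rx (normr_le_enorm _).
have Kin z : K z -> s0 <= z.2 < b by move=> [_ /andP[? ?]]; apply/andP; split; lra.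
have cpen s : s < b -> {for s, continuous pen}.
  move=> sb; apply: cvgM; first exact: cvg_cst.
  apply: (@continuous_comp _ _ _ (fun s => b - s) (@powR R ^~ (-1))).
    by apply: cvgB; [exact: cvg_cst|exact: cvg_id].
  apply: differentiable_continuous; apply/derivable1_diffP.
  by have [] := @is_derive1_powR R (-1) (b - s) ltac:(lra).
have cK : {within K, continuous (w - psi)}.
  have cwK : {within K, continuous w}.
    apply: continuous_subspaceW cw => z /Kin; exact: clT.
  have cpsiK : {within K, continuous psi}.
    apply: continuous_in_subspaceT => z' /[!inE] /Kin zin.
    apply: cvgD; first exact: cphi.
    apply: (@continuous_comp _ _ _ snd pen); first exact: cvg_snd.
    by apply: cpen; case/andP: zin.
  by move=> z; exact: cvgB (cwK z) (cpsiK z).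
have compK : compact K by exact: compact_cylinder.
have [[x t] Kz max] := compact_EVT_max (ex_intro _ _ Kx1) compK cK.
have {}Kz : K (x, t) by rewrite inE in Kz.
have {}max z : K z -> (w - psi) z <= (w - psi) (x, t) by move=> zK; apply: max; rewrite inE.
have wpE z : (w - psi) z = w z - phi z - pen z.2.
  by rewrite -addrA -opprD.
(* The penalization at t1 equals c / 2, half of the excess of w there. *)
have pos : 0 < (w - psi) (x, t).
  apply: lt_le_trans (max _ Kx1); rewrite wpE penE// -/c /gam.
  rewrite mulrAC mulfK ?gt_eqF//; lra.
have pen0 s : s < b -> 0 < pen s.
  by move=> sb; rewrite penE// divr_gt0//; lra.
have /andP[st tb] := Kin _ Kz.
rewrite /= in st tb.
have phiw : phi (x, t) < w (x, t).
  by move: pos; rewrite wpE; have := pen0 t tb => /=; lra.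
have st' : s0 < t.
  rewrite lt_neqAle st andbT; apply/eqP => s0t.
  by move: phiw; rewrite -s0t ltNge init.
have [A [g [ft [A0 dt dx phiA HA]]]] := strict x t ltac:(by apply/andP) phiw.
have dpen : is_derive t 1 pen (gam * (-1 * (b - t) `^ (-1 - 1) * -1)).
  have bt : 0 < b - t by lra.
  have d1 : is_derive t 1 (fun s => b - s) (-1).
    by have := is_deriveB (is_derive_cst b t 1) (is_derive_id t (1 : R)); rewrite sub0r.
  exact: (is_deriveZ gam (is_derive_comp d1 (is_derive1_powR (-1) bt))).
have psi2 : C2_on (time_slab s0 b) psi.
  have oI := @open_time_slab R N s0 b.
  apply: (C2_onD oI phi2).
  have C : C2_on (@time_slab R N s0 b) ((fun=> b) + - snd).
    exact: C2_onD oI (C2_on_cst _ _) (C2_onN oI (C2_on_time oI)).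
  have Cpos z : @time_slab R N s0 b z -> 0 < ((fun=> b) + - snd) z.
    by move=> /andP[_]; rewrite -subr_gt0.
  exact: C2_onM oI (C2_on_cst _ gam) (C2_on_powR (-1) oI Cpos C).
have psimax z : time_slab s0 b z -> w z - psi z <= w (x, t) - psi (x, t).
  move=> /andP[sz zb].
  have -> : w z - psi z = (w - psi) z by [].
  have -> : w (x, t) - psi (x, t) = (w - psi) (x, t) by [].
  have [zr|zr] := leP `|z.1 - y| r; last first.
    apply: ltW; apply: le_lt_trans pos; rewrite wpE.
    have : w z <= phi z.
      case: z sz zb zr => z1 z2 /= sz zb zr; apply: far; first by rewrite (ltW sz).
      exact: lt_le_trans zr (normr_le_enorm _).
    by have := pen0 _ zb; lra.
  have [ze|ze] := leP z.2 (b - e); first by apply: max; split=> //; rewrite ze ltW.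
  apply: ltW; apply: le_lt_trans pos; rewrite wpE.
  have zin : s0 <= z.2 < b by rewrite ltW.
  have wz : w z <= M.
    by have := wM z (clT _ zin); rewrite ler_norml => /andP[].
  have pz : M + `|B| + 1 <= pen z.2.
    rewrite penE// ler_pdivlMr; last by lra.
    rewrite mulrC -ler_pdivlMr//; apply: le_trans e1; lra.
  by have := phiB _ zin; have := ler_norm B; lra.
have psidx v : is_derive x v (fun y => psi (y, t)) (dotv g v).
  have := is_deriveD (dx v) (is_derive_cst (pen t) x v).
  by rewrite addr0.
have psiA y' : psi (x + y', t) - psi (x, t) - dotv g y' <= A * dotv y' y'.
  by rewrite !psiE /=; have := phiA y'; lra.
have tab : s0 < t < b by apply/andP.
have := wH s0 b psi x g t A _ s00 bT tab psi2 psimax (is_deriveD dt dpen) psidx A0 psiA.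
have : 0 < gam * (-1 * (b - t) `^ (-1 - 1) * -1).
  by rewrite mulr_gt0// mulN1r mulrN1 opprK powR_gt0; lra.
by lra.
Qed.

(** * Supersolutions above a concave paraboloid *)

Lemma is_derive_sqdist (R : realType) (N : nat) (x y v : 'rV[R]_N) :
  is_derive x v (fun x => dotv (x - y) (x - y)) (2 * dotv (x - y) v).
Proof.
apply/is_derive_line; apply: (@is_derive_quadratic_error _ _ _ _ (dotv v v)) => h _.
rewrite addr0 scale0r add0r -(addrA (h *: v) x); move: (x - y) => w.
rewrite !(dotvDl, dotvDr, dotvZl, dotvZr). rewrite (dotvC v w).
rewrite (_ : _ - h * (2 * dotv w v) = dotv v v * h ^+ 2); last by ring.
by rewrite ger0_norm// mulr_ge0 ?sqr_ge0// dotvv_ge0.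
Qed.

Lemma sqdist_add (R : realType) (N : nat) (x y v : 'rV[R]_N) :
  dotv (x + v - y) (x + v - y) =
    dotv (x - y) (x - y) + 2 * dotv (x - y) v + dotv v v.
Proof.
by rewrite addrAC; move: (x - y) => w; rewrite !(dotvDl, dotvDr) (dotvC v w); ring.
Qed.

(** Beyond distance rho the paraboloid is below u by assumption, so a crossing can occur only where
    its gradient is at most 2 A rho. There [CB] bounds all terms of the equation other than the time
    derivative. *)
Lemma quadratic_lower_bound (R : realType) (N : nat) (q delta T M s0 b A rho a CB : R)
    (x0 : 'rV[R]_N) (u : 'rV[R]_N * R -> R) :
  0 <= s0 -> b <= T -> 0 <= delta -> 0 <= A -> 0 <= q ->
  {within closed_slab T, continuous u} ->
  (forall z, closed_slab T z -> `|u z| <= M) ->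
  viscosity_supersolution (F_super q delta) T u ->
  (forall x, a - A * dotv (x - x0) (x - x0) <= u (x, s0)) ->
  (forall x t, s0 <= t < b -> rho < enorm (x - x0) ->
    a - A * dotv (x - x0) (x - x0) <= u (x, t)) ->
  delta * A + delta * (2 * A * rho) `^ q + delta <= CB ->
  forall x t, s0 <= t < b ->
    a - A * dotv (x - x0) (x - x0) - CB * (t - s0) <= u (x, t).
Proof.
move=> s00 bT d0 A0 q0 cu uM usup init far hCB.
have CB0 : 0 <= CB.
  by apply: le_trans hCB; rewrite !addr_ge0// mulr_ge0// powR_ge0.
pose phi (z : 'rV[R]_N * R) := - a + A * dotv (z.1 - x0) (z.1 - x0) + CB * (z.2 - s0).
have uMN z : closed_slab T z -> `|(- u) z| <= M by move=> /uM; rewrite normrN.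
have cNu : {within closed_slab T, continuous (- u)} by move=> z; exact: cvgN (cu z).
have phi2 (Om : set ('rV[R]_N * R)) : open Om -> C2_on Om phi.
  move=> oO; have k c : C2_on Om (fun=> c) by exact: C2_on_cst.
  exact: C2_onD oO (C2_onD oO (k _) (C2_onM oO (k _) (C2_on_sqdist x0 oO)))
    (C2_onM oO (k _) (C2_onD oO (C2_on_time oO) (k _))).
have cphi z : {for z, continuous phi}.
  by have [c _ _] := phi2 _ (@openT _); exact: c.
have phiB z : s0 <= z.2 < b -> - `|a| <= phi z.
  move=> /andP[sz _]; rewrite /phi -addrA -[leLHS]addr0 lerD//.
    by rewrite lerN2 ler_norm.
  by rewrite addr_ge0// mulr_ge0// ?dotvv_ge0// subr_ge0.
have NE z : (- u) z = - u z by [].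
have key x t : s0 <= t < b -> (- u) (x, t) <= phi (x, t).
  apply: (comparison s00 bT (supersolution_touching d0 uM usup) cNu uMN
    (phi2 _ (@open_time_slab R N s0 b)) (fun z _ => cphi z) phiB
    (y := x0) (r := rho)).
  - by move=> {}x; rewrite NE /phi /= subrr mulr0 addr0; have := init x; lra.
  - move=> {}x {}t tb xrho; rewrite NE /phi /=; have := far x t tb xrho.
    have : 0 <= CB * (t - s0) by rewrite mulr_ge0//; case/andP: tb; lra.
    lra.
  - move=> {}x {}t /andP[st tb] phiu.
    have xrho : enorm (x - x0) <= rho.
      rewrite leNgt; apply/negP => xrho; move: phiu.
      rewrite ltNge => /negP; apply; rewrite NE /phi /=.
      have stb : s0 <= t < b by rewrite (ltW st).
      have := far x t stb xrho.
      have : 0 <= CB * (t - s0) by rewrite mulr_ge0//; lra.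
      lra.
    exists A, ((2 * A) *: (x - x0)), CB; split; first exact: A0.
    + apply: (@is_derive_quadratic_error _ _ _ _ 0) => h _.
      rewrite /phi /=; set D := A * _.
      have -> : - a + D + CB * (h + t - s0) - (- a + D + CB * (t - s0)) - h * CB = 0 by ring.
      by rewrite normr0 mul0r.
    + move=> v; rewrite /phi /=.
      have := is_deriveD (is_deriveD (is_derive_cst (- a) x v)
        (is_deriveZ A (is_derive_sqdist x x0 v))) (is_derive_cst (CB * (t - s0)) x v).
      rewrite addr0 add0r dotvZl.
      have -> : A *: (2 * dotv (x - x0) v) = 2 * A * dotv (x - x0) v.
        by rewrite [LHS]mulrCA mulrA.
      by [].
    + by move=> y; rewrite /phi /= sqdist_add dotvZl; lra.
    + apply: le_trans hCB; rewrite lerD2r lerD2l ler_wpM2l//.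
      rewrite ge0_ler_powR ?nnegrE ?enorm_ge0//.
        by rewrite !mulr_ge0//; apply: le_trans xrho; exact: enorm_ge0.
      rewrite enormZ ger0_norm ?mulr_ge0//.
      by rewrite ler_wpM2l// mulr_ge0.
by move=> x t tb; have := key x t tb; rewrite NE /phi /=; lra.
Qed.

(** * Growth of subsolutions *)

Section RealPowers.
Variable R : realType.
Implicit Types (p q k s z : R).

Lemma powR_bernoulli z k : 0 <= z -> 0 < k < 1 -> z `^ k <= 1 + k * (z - 1).
Proof.
move=> z0 /andP[k0 k1].
have kV : 0 < k^-1 by rewrite invr_gt0.
have kV' : 0 < (1 - k)^-1 by rewrite invr_gt0 subr_gt0.
(* Young's inequality for z^k and 1, with exponents 1/k and 1/(1 - k). *)
have := @conjugate_powR R (z `^ k) 1 k^-1 (1 - k)^-1 (powR_ge0 _ _) ler01 kV kV'.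
rewrite !invrK addrC subrK -powRrM mulfV ?gt_eqF// powRr1// powR1 !mulr1.
by move=> /(_ erefl); lra.
Qed.

Lemma powR_le_tangent s s' k : 0 < s -> 0 <= s' -> 0 < k < 1 ->
  s' `^ k <= s `^ k + k * s `^ (k - 1) * (s' - s).
Proof.
move=> s0 s'0 k01; have sn0 : s != 0 by rewrite gt_eqF.
have -> : s' = s * (s' / s) by rewrite mulrC divfK.
set z := s' / s; have z0 : 0 <= z by rewrite divr_ge0// ltW.
rewrite powRM ?(ltW s0)// powRB ?sn0 ?implybT// powRr1 ?(ltW s0)//.
have := ler_wpM2l (powR_ge0 s k) (powR_bernoulli z0 k01).
suff -> : s `^ k + k * (s `^ k / s) * (s * z - s) = s `^ k * (1 + k * (z - 1)) by [].
by field.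
Qed.

Lemma powRDge0 s a b : 0 < s -> s `^ (a + b) = s `^ a * s `^ b.
Proof. by move=> s0; rewrite powRD// (gt_eqF s0) implybT. Qed.

Lemma le_powR k s s' : 0 <= k -> 0 <= s -> s <= s' -> s `^ k <= s' `^ k.
Proof. by move=> k0 s0 ss; rewrite ge0_ler_powR ?nnegrE//; apply: le_trans ss. Qed.

Lemma le_powRN k s s' : k <= 0 -> 0 < s -> s <= s' -> s' `^ k <= s `^ k.
Proof.
move=> k0 s0 ss; rewrite -[k]opprK !(powRN _ (- k)) lef_pV2 ?posrE ?powR_gt0//.
  by apply: le_powR; rewrite ?oppr_ge0// ltW.
exact: lt_le_trans ss.
Qed.

Lemma powR2_le k : k <= 1 -> (2 : R) `^ k <= 2.
Proof. by move=> k1; rewrite -[leRHS]powRr1// ler_powR// ler1n. Qed.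

Lemma powR_add_le k a b : 0 <= k <= 1 -> 0 <= a -> 0 <= b ->
  (a + b) `^ k <= 2 * (a `^ k + b `^ k).
Proof.
move=> /andP[k0 k1] a0 b0.
have h c : 0 <= c -> (2 * c) `^ k <= 2 * c `^ k.
  by move=> c0; rewrite powRM// ler_wpM2r ?powR_ge0// powR2_le.
have [ab|/ltW ab] := leP a b.
  apply: le_trans (_ : (2 * b) `^ k <= _); first by rewrite le_powR ?addr_ge0//; lra.
  by apply: le_trans (h b b0) _; have := powR_ge0 a k; lra.
apply: le_trans (_ : (2 * a) `^ k <= _); first by rewrite le_powR ?addr_ge0//; lra.
by apply: le_trans (h a a0) _; have := powR_ge0 b k; lra.
Qed.

End RealPowers.

(** With Y = S^(p/2) sg^(-p), the only negative term on the right is - (p - 1) C Y. If D^2 <= sg,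
    then Y <= 2 sg^(-p/2) and the term with C (delta + 2) pays for it. Otherwise D >= S^(1/2) / 2
    and, because (p - 1) q = p, the power G^q dominates a multiple of Y, as for the Hopf-Lax kernel;
    C = 4 delta makes G^q / delta >= C Y. *)
Lemma barrier_inequality (R : realType) (p q delta D sg S C : R) :
  1 < p -> p < 2 -> 2 < q -> (p - 1) * q = p -> 1 <= delta ->
  0 <= D -> 0 < sg -> S = D ^+ 2 + sg -> C = 4 * delta ->
  delta * (C * (p / 2) * sg `^ (- (p / 2))) + delta
    - delta^-1 * (C * p * S `^ (p / 2 - 1) * sg `^ (1 - p) * D) `^ q <=
  C * (p / 2 * S `^ (p / 2 - 1) * sg `^ (1 - p) + (1 - p) * S `^ (p / 2) * sg `^ (- p))
    + C * (delta + 2) * sg `^ (- (p / 2)) + 2 * delta.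
Proof.
move=> p1 p2 q2 pq delta1 D0 sg0 SE CE.
have S0 : 0 < S by rewrite SE ltr_wpDl ?sqr_ge0.
have d0 : 0 < delta by apply: lt_le_trans delta1.
have C0 : 0 < C by rewrite CE mulr_gt0.
set X := sg `^ (- (p / 2)); have X0 : 0 <= X := powR_ge0 _ _.
set Y := S `^ (p / 2) * sg `^ (- p).
have Y0 : 0 <= Y by rewrite mulr_ge0// powR_ge0.
have CY : 0 <= C * Y := mulr_ge0 (ltW C0) Y0.
set G := C * p * _ * _ * D.
set Z := p / 2 * _ * _; have Z0 : 0 <= Z by rewrite !mulr_ge0// ?powR_ge0//; lra.
rewrite -(mulrA (1 - p)) -/Y.
have X1 : delta * (C * (p / 2) * X) <= C * delta * X.
  have : 0 <= C * X * delta * (1 - p / 2).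
    by rewrite !mulr_ge0// ?(ltW C0) ?(ltW d0)//; lra.
  lra.
have dG0 : 0 <= delta^-1 * G `^ q by rewrite mulr_ge0 ?powR_ge0// invr_ge0; lra.
have CZ : 0 <= C * Z by rewrite mulr_ge0// ltW.
have [Dsg|/ltW sgD] := leP (D ^+ 2) sg.
  have YX : Y <= 2 * X.
    have -> : X = sg `^ (p / 2) * sg `^ (- p).
      by rewrite -powRDge0//; congr (_ `^ _); field.
    rewrite mulrA ler_wpM2r ?powR_ge0//.
    apply: le_trans (_ : (2 * sg) `^ (p / 2) <= _).
      by apply: le_powR; [lra|exact: ltW|rewrite SE; lra].
    by rewrite powRM ?(ltW sg0)// ler_wpM2r ?powR_ge0// powR2_le; lra.
  have : (p - 1) * C * Y <= 2 * C * X.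
    have : 0 <= (2 - p) * (C * Y) by apply: mulr_ge0 => //; lra.
    have := ler_wpM2l (ltW C0) YX; lra.
  by lra.
have GY : 2 * delta * Y `^ (q^-1) <= G.
  have q0 : q != 0 by lra.
  have qV : q^-1 = (p - 1) / p.
    have p0 : p != 0 by lra.
    apply: (mulfI q0); rewrite mulfV//; apply: (mulIf p0).
    by rewrite mul1r mulrA divfK// mulrC pq.
  have -> : Y `^ q^-1 = S `^ (p / 2 - 1) * sg `^ (1 - p) * S `^ (2^-1).
    have p0 : p != 0 by lra.
    rewrite /Y powRM ?powR_ge0// -!powRrM qV [RHS]mulrAC -powRDge0//.
    by congr (_ `^ _ * _ `^ _); field.
  have SD : S `^ 2^-1 <= 2 * D.
    rewrite powR12_sqrt ?(ltW S0)// -[leRHS]ger0_norm ?mulr_ge0// -sqrtr_sqr.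
    by rewrite ler_wsqrtr// SE; have := sqr_ge0 D; lra.
  rewrite /G CE; set E := S `^ _; set F := sg `^ _.
  have EF : 0 <= E * F by rewrite mulr_ge0// powR_ge0.
  have : 2 * delta * (E * F * S `^ 2^-1) <= 2 * delta * (E * F * (2 * D)).
    by rewrite ler_wpM2l ?ler_wpM2l//; lra.
  have : 0 <= delta * (E * F) * D * (p - 1).
    apply: mulr_ge0; last by lra.
    by apply: mulr_ge0 => //; apply: mulr_ge0 => //; exact: ltW.
  lra.
have GqY : C * Y <= delta^-1 * G `^ q.
  have : (2 * delta * Y `^ q^-1) `^ q <= G `^ q.
    apply: le_powR => //; first by lra.
    by apply: mulr_ge0; [lra|exact: powR_ge0].
  have q0 : q != 0 by lra.
  rewrite powRM ?powR_ge0//; last by lra.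
  rewrite -powRrM mulVf// powRr1// => h.
  rewrite -ler_pdivrMl ?invr_gt0; last by lra.
  rewrite invrK; apply: le_trans h.
  rewrite mulrA ler_wpM2r//.
  (* The value of C enters here: delta C = (2 delta)^2 <= (2 delta)^q. *)
  apply: le_trans (_ : (2 * delta) `^ 2 <= _); last by rewrite ler_powR; lra.
  by rewrite powR_mulrn; [rewrite CE; nra|lra].
have : 0 <= (2 - p) * (C * Y) by apply: mulr_ge0 => //; lra.
have : 0 <= C * X by rewrite mulr_ge0// ltW.
lra.
Qed.

Lemma slab_continuity (R : realType) (N : nat) (T : R) (u : 'rV[R]_N * R -> R)
    (x : 'rV[R]_N) (t e : R) :
  {within closed_slab T, continuous u} -> 0 <= t <= T -> 0 < e ->
  exists2 r, 0 < r & forall x' t', 0 <= t' <= T -> `|x - x'| < r -> `|t - t'| < r ->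
    `|u (x, t) - u (x', t')| < e.
Proof.
move=> /subspace_continuousP cu tT e0.
have Oxt : closed_slab T (x, t) by exact/closed_slabP.
have /cvgrPdist_lt/(_ _ e0) := cu (x, t) Oxt.
rewrite near_withinE => /nbhs_ballP[r /= r0 ru].
exists r => // x' t' tT' xr tr; apply: (ru (x', t')); last exact/closed_slabP.
by split; rewrite -ball_normE.
Qed.

(** * The Lax type barrier and its derivatives *)

Section SingularBarrier.
Variables (R : realType) (N : nat) (p delta C C' m s0 e : R) (y : 'rV[R]_N).

(** A positive [e] starts the clock before s0 and makes the barrier smooth up to s0. The time
    derivatives of the last two terms absorb the error sg^(-p/2) and the constants of the
    equation. *)
Definition singular_barrier (z : 'rV[R]_N * R) : R :=
  let sg := z.2 - s0 + e in
  m + C * ((dotv (z.1 - y) (z.1 - y) + sg) `^ (p / 2) * sg `^ (1 - p))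
    + C' * sg `^ (1 - p / 2) + 2 * delta * sg.

Lemma C2_on_singular_barrier (Om : set ('rV[R]_N * R)) : open Om ->
  (forall z, Om z -> s0 - e < z.2) -> C2_on Om singular_barrier.
Proof.
move=> oO Oz; have k c : C2_on Om (fun=> c) by exact: C2_on_cst.
pose sg : 'rV[R]_N * R -> R := snd + (fun=> - s0) + (fun=> e).
have sg2 : C2_on Om sg.
  exact: C2_onD oO (C2_onD oO (C2_on_time oO) (k _)) (k _).
have sgE z : sg z = z.2 - s0 + e by [].
have sg0 z : Om z -> 0 < sg z by move=> /Oz; rewrite sgE; lra.
pose S : 'rV[R]_N * R -> R := (fun z => dotv (z.1 - y) (z.1 - y)) + sg.
have S2 : C2_on Om S by exact: C2_onD oO (C2_on_sqdist y oO) sg2.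
have S0 z : Om z -> 0 < S z by move=> /sg0 h; exact: ltr_wpDl (dotvv_ge0 _) h.
have := C2_onD oO (C2_onD oO (C2_onD oO (k m) (C2_onM oO (k C)
  (C2_onM oO (C2_on_powR (p / 2) oO S0 S2) (C2_on_powR (1 - p) oO sg0 sg2))))
  (C2_onM oO (k C') (C2_on_powR (1 - p / 2) oO sg0 sg2)))
  (C2_onM oO (k (2 * delta)) sg2).
by apply: (C2_on_eq oO) => z _.
Qed.

Lemma is_derive_singular_barrier_time x t : s0 - e < t ->
  let sg := t - s0 + e in let S := dotv (x - y) (x - y) + sg in
  is_derive t 1 (fun s => singular_barrier (x, s))
    (C * (p / 2 * S `^ (p / 2 - 1) * sg `^ (1 - p) +
          (1 - p) * S `^ (p / 2) * sg `^ (- p))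
     + C' * (1 - p / 2) * sg `^ (- (p / 2)) + 2 * delta).
Proof.
move=> te sg S.
have sg0 : 0 < sg by rewrite /sg; lra.
have S0 : 0 < S by exact: ltr_wpDl (dotvv_ge0 _) sg0.
have dsg : is_derive t 1 (fun s => s - s0 + e) 1.
  apply: (@is_derive_quadratic_error _ _ _ _ 0) => h _.
  by rewrite (_ : h + t - s0 + e - (t - s0 + e) - h * 1 = 0) ?normr0 ?mul0r//; ring.
have dS : is_derive t 1 (fun s => dotv (x - y) (x - y) + (s - s0 + e)) 1.
  apply: (@is_derive_quadratic_error _ _ _ _ 0) => h _; set D := dotv _ _.
  rewrite (_ : D + (h + t - s0 + e) - (D + (t - s0 + e)) - h * 1 = 0) ?normr0 ?mul0r//.
  by ring.
have dSp := is_derive_comp dS (is_derive1_powR (p / 2) S0).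
have dsp := is_derive_comp dsg (is_derive1_powR (1 - p) sg0).
have dsp' := is_derive_comp dsg (is_derive1_powR (1 - p / 2) sg0).
have := is_deriveD (is_deriveD (is_deriveD (is_derive_cst m t (1 : R))
  (is_deriveZ C (is_deriveM dSp dsp))) (is_deriveZ C' dsp')) (is_deriveZ (2 * delta) dsg).
set f := (X in is_derive _ _ X _ -> _).
have -> : (fun s => singular_barrier (x, s)) = f by apply/funext.
move=> df; apply: is_derive_eq df _.
rewrite /GRing.scale /= -/sg -/S !mulr1 add0r.
have -> : 1 - p - 1 = - p by ring.
have -> : 1 - p / 2 - 1 = - (p / 2) by ring.
congr (_ * _ + _ + _); [ring|by rewrite mulrA].
Qed.

Lemma is_derive_singular_barrier_space x t v : s0 - e < t ->
  let sg := t - s0 + e in let S := dotv (x - y) (x - y) + sg in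
  is_derive x v (fun x => singular_barrier (x, t))
    (dotv ((C * p * S `^ (p / 2 - 1) * sg `^ (1 - p)) *: (x - y)) v).
Proof.
move=> te sg S.
have sg0 : 0 < sg by rewrite /sg; lra.
have S0 : 0 < S by exact: ltr_wpDl (dotvv_ge0 _) sg0.
have dS : is_derive x v (fun x => dotv (x - y) (x - y) + sg) (2 * dotv (x - y) v).
  by have := is_deriveD (is_derive_sqdist x y v) (is_derive_cst sg x v); rewrite addr0.
have dSp := is_derive_comp dS (is_derive1_powR (p / 2) S0).
have := is_deriveD (is_deriveD (is_deriveD (is_derive_cst m x v)
  (is_deriveZ C (is_deriveM dSp (is_derive_cst (sg `^ (1 - p)) x v))))
  (is_derive_cst (C' * sg `^ (1 - p / 2)) x v)) (is_derive_cst (2 * delta * sg) x v).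
set f := (X in is_derive _ _ X _ -> _).
have -> : (fun x => singular_barrier (x, t)) = f by apply/funext.
move=> df; apply: is_derive_eq df _.
rewrite /GRing.scale /= -/S dotvZl mulr0 !addr0 !add0r.
by field.
Qed.

(** The tangent of the concave power p/2 at S, evaluated at S + 2 B + V, gives the gradient term
    from 2 B and the remainder from V. Since S >= sg and p/2 - 1 < 0, the factor S^(p/2-1) is at
    most sg^(p/2-1), which does not depend on x. *)
Lemma singular_barrier_second_order x t v sg S : 0 <= C -> 1 < p < 2 -> s0 - e < t ->
  sg = t - s0 + e -> S = dotv (x - y) (x - y) + sg ->
  singular_barrier (x + v, t) - singular_barrier (x, t)
    - dotv ((C * p * S `^ (p / 2 - 1) * sg `^ (1 - p)) *: (x - y)) v <=
  C * (p / 2) * sg `^ (- (p / 2)) * dotv v v.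
Proof.
move=> C0 /andP[p1 p2] te sgE SE.
have sg0 : 0 < sg by rewrite sgE; lra.
have S0 : 0 < S by rewrite SE; exact: ltr_wpDl (dotvv_ge0 _) sg0.
rewrite /singular_barrier /= -sgE sqdist_add dotvZl -SE.
set B := dotv (x - y) v; set V := dotv v v.
have V0 : 0 <= V := dotvv_ge0 _.
set S' := _ + sg; have S'E : S' = S + 2 * B + V by rewrite /S' SE; ring.
have S'0 : 0 <= S'.
  rewrite /S' /B /V -sqdist_add; exact: addr_ge0 (dotvv_ge0 _) (ltW sg0).
have p01 : 0 < p / 2 < 1 by apply/andP; split; lra.
have := powR_le_tangent S0 S'0 p01; rewrite S'E.
have -> : S + 2 * B + V - S = 2 * B + V by ring.
rewrite -S'E => tang.
have F0 : 0 <= C * sg `^ (1 - p) by rewrite mulr_ge0 ?powR_ge0.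
have h1 := ler_wpM2l F0 tang.
have Sle : S `^ (p / 2 - 1) <= sg `^ (p / 2 - 1).
  by apply: le_powRN => //; [lra|rewrite SE lerDr dotvv_ge0].
have h2 : C * sg `^ (1 - p) * (p / 2 * S `^ (p / 2 - 1) * V) <=
    C * sg `^ (1 - p) * (p / 2 * sg `^ (p / 2 - 1) * V).
  by rewrite ler_wpM2l// ler_wpM2r// ler_wpM2l//; lra.
have E : sg `^ (- (p / 2)) = sg `^ (1 - p) * sg `^ (p / 2 - 1).
  by rewrite -powRDge0//; congr (_ `^ _); field.
by rewrite E; lra.
Qed.

End SingularBarrier.

(** The coefficients 4 delta, C' and 2 delta of the barrier, times 4, 2 and 2: the cost of splitting
    (D^2 + sg)^(p/2) and of sg <= 2 (t - s0). *)
Definition growth_constant (R : realType) (p delta : R) : R :=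
  16 * delta + 2 * (4 * delta * (delta + 2) / (1 - p / 2)) + 4 * delta.

Lemma growth_constant_ge1 (R : realType) (p delta : R) :
  p < 2 -> 1 <= delta -> 1 <= growth_constant p delta.
Proof.
move=> p2 d1; rewrite /growth_constant.
have : 0 <= 4 * delta * (delta + 2) / (1 - p / 2).
  by apply: divr_ge0; [apply: mulr_ge0; lra|lra].
lra.
Qed.

Lemma sqr_powR_half (R : realType) (D p : R) : 0 <= D -> (D ^+ 2) `^ (p / 2) = D `^ p.
Proof. by move=> D0; rewrite -powR_mulrn// -powRrM; congr (_ `^ _); field. Qed.

Lemma singular_barrier_ge (R : realType) (N : nat) (p delta C C' m s0 e : R)
    (y x : 'rV[R]_N) (t : R) :
  0 <= p -> 0 <= delta -> 0 <= C -> 0 <= C' -> 0 <= t - s0 + e ->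
  m + C * (enorm (x - y) `^ p * (t - s0 + e) `^ (1 - p)) <=
    singular_barrier p delta C C' m s0 e y (x, t).
Proof.
move=> p0 d0 C0 C'0; rewrite /singular_barrier /=; set sg := _ - s0 + e => sg0.
have h : enorm (x - y) `^ p <= (dotv (x - y) (x - y) + sg) `^ (p / 2).
  rewrite -sqr_powR_half ?enorm_ge0// enorm_sqr.
  by apply: le_powR; [lra|exact: dotvv_ge0|rewrite lerDl].
have h1 : C * (enorm (x - y) `^ p * sg `^ (1 - p)) <=
    C * ((dotv (x - y) (x - y) + sg) `^ (p / 2) * sg `^ (1 - p)).
  by rewrite ler_wpM2l// ler_wpM2r ?powR_ge0.
have h2 : 0 <= C' * sg `^ (1 - p / 2) by rewrite mulr_ge0 ?powR_ge0.
have h3 : 0 <= 2 * delta * sg by rewrite !mulr_ge0.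
lra.
Qed.

(** At time s0 the barrier is above u near y by continuity and the margin k, and elsewhere because
    e^(1-p) is large. The bound e <= t - s0 keeps the barrier at time t comparable with the one for
    e = 0, so that e does not have to tend to 0. *)
Lemma subsolution_below_barrier (R : realType) (N : nat) (q p delta T M s0 t k : R)
    (u : 'rV[R]_N * R -> R) (x y : 'rV[R]_N) :
  1 < p -> p < 2 -> 2 < q -> (p - 1) * q = p -> 1 <= delta ->
  {within closed_slab T, continuous u} ->
  (forall z, closed_slab T z -> `|u z| <= M) ->
  viscosity_subsolution (F_sub q delta) T u ->
  0 <= s0 -> s0 < t -> t < T -> 0 < k ->
  exists2 e, 0 < e <= t - s0 &
    u (x, t) <= singular_barrier p delta (4 * delta)
      (4 * delta * (delta + 2) / (1 - p / 2)) (u (y, s0) + k) s0 e y (x, t).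
Proof.
move=> p1 p2 q2 pq d1 cu uM usub s00 st tT k0.
set C := 4 * delta; set C' := _ / (1 - p / 2); set m := u (y, s0) + k.
have C0 : 0 < C by rewrite /C; lra_from d1.
have C'0 : 0 <= C'.
  by rewrite /C'; apply: divr_ge0; [apply: mulr_ge0; [exact: ltW|lra_from d1]|lra_from p2].
have d0 : 0 <= delta by lra_from d1.
have p0 : 0 <= p by lra_from p1.
have uMb z : closed_slab T z -> - M <= u z <= M by move=> /uM; rewrite ler_norml.
have s0T (x' : 'rV[R]_N) : closed_slab T (x', s0) by apply/closed_slabP/andP; split=> /=; lra_from s00 st tT.
have M0 : 0 <= M by exact: le_trans (normr_ge0 _) (uM _ (s0T y)).
have mM : - M <= m.
  by have /andP[h _] := uMb _ (s0T y); rewrite /m; lra_from h k0.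
have s0in : 0 <= s0 <= T by apply/andP; split; lra_from s00 st tT.
have [r0 r00 ur0] := slab_continuity y cu s0in k0.
(* For e <= E one has C r0^p e^(1-p) >= 2 M + 1, more than u - m can be. *)
pose E := (C * r0 `^ p / (2 * M + 1)) `^ (p - 1)^-1.
have q0 : 0 < C * r0 `^ p / (2 * M + 1).
  by apply: divr_gt0; [apply: mulr_gt0 => //; exact: powR_gt0|lra_from M0].
have E0 : 0 < E by exact: powR_gt0.
pose e := Num.min E (t - s0).
have e0 : 0 < e by rewrite lt_min E0 subr_gt0.
have [eE ed] : e <= E /\ e <= t - s0 by rewrite /e !ge_min !lexx orbT.
exists e; first by rewrite e0.
set phi := singular_barrier _ _ _ _ _ _ _ _.
have T0 : 0 < T by lra_from s00 st tT.
(* T1 bounds the shifted elapsed time, so c bounds C sg^(1-p) from below, and beyond distance r the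
   barrier exceeds m + 2 M >= M. *)
pose T1 := T + T; have T10 : 0 < T1 by exact: addr_gt0.
pose c := C * T1 `^ (1 - p); have c0 : 0 < c by rewrite mulr_gt0// powR_gt0.
pose r := 1 + 2 * M / c.
have r1 : 1 <= r by rewrite lerDl; apply: divr_ge0; [exact: mulr_ge0|exact: ltW].
have phige (x' : 'rV[R]_N) t' : s0 <= t' -> m + C * (enorm (x' - y) `^ p * (t' - s0 + e) `^ (1 - p))
    <= phi (x', t').
  by move=> h; apply: singular_barrier_ge => //; [exact: ltW|lra_from h e0].
have phi2 (Om : set ('rV[R]_N * R)) : open Om -> (forall z, Om z -> s0 - e < z.2) ->
    C2_on Om phi by exact: C2_on_singular_barrier.
have cphi z : s0 <= z.2 < T -> {for z, continuous phi}.
  move=> /andP[sz zT].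
  have [|cc _ _] := phi2 _ (@open_time_slab R N (s0 - e) T).
    by move=> z' /andP[].
  by apply: cc; rewrite /time_slab /= zT andbT; lra_from sz e0.
have phiB z : s0 <= z.2 < T -> - M <= phi z.
  case: z => x' t' /= /andP[h _]; apply: le_trans (phige x' t' h).
  have : 0 <= C * (enorm (x' - y) `^ p * (t' - s0 + e) `^ (1 - p)).
    by apply: mulr_ge0; [exact: ltW|apply: mulr_ge0; exact: powR_ge0].
  by move=> h'; lra_from h' mM.
have phi2' : C2_on (time_slab s0 T) phi.
  by apply: phi2 (@open_time_slab R N s0 T) _ => z /andP[h _]; lra_from h e0.
apply: (comparison s00 (lexx T) (subsolution_touching d0 uM usub) cu uM phi2' cphi phiB
  (y := y) (r := r)).
- move=> x'; have [xr|xr] := ltP `|y - x'| r0.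
    apply: le_trans (_ : m <= _).
      have := ur0 x' s0 s0in xr; rewrite subrr normr0 => /(_ r00).
      by rewrite ltr_norml => /andP[h _]; rewrite /m; lra_from h.
    apply: le_trans (phige x' s0 (lexx _)); rewrite lerDl.
    by apply: mulr_ge0; [exact: ltW|apply: mulr_ge0; exact: powR_ge0].
  apply: le_trans (phige x' s0 (lexx _)).
  have Dr : r0 <= enorm (x' - y).
    by apply: le_trans xr _; rewrite distrC; exact: normr_le_enorm.
  rewrite subrr add0r.
  have h1 : r0 `^ p <= enorm (x' - y) `^ p by apply: le_powR => //; exact: ltW.
  have h2 : (C * r0 `^ p / (2 * M + 1))^-1 <= e `^ (1 - p).
    have -> : 1 - p = - (p - 1) by ring.
    rewrite powRN lef_pV2 ?posrE ?powR_gt0//.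
    apply: le_trans (_ : E `^ (p - 1) <= _).
      by apply: le_powR => //; [lra_from p1|exact: ltW].
    by rewrite /E -powRrM mulVf ?powRr1 ?(ltW q0)// lt0r_neq0// subr_gt0.
  have h3 : 2 * M + 1 <= C * (enorm (x' - y) `^ p * e `^ (1 - p)).
    have : r0 `^ p * (C * r0 `^ p / (2 * M + 1))^-1 <= enorm (x' - y) `^ p * e `^ (1 - p).
      apply: ler_pM => //; first exact: powR_ge0.
      by rewrite invr_ge0 ltW.
    move=> /(ler_wpM2l (ltW C0)); apply: le_trans.
    have rp : 0 < r0 `^ p by rewrite powR_gt0.
    rewrite le_eqVlt; apply/orP; left; apply/eqP; field.
    by rewrite !lt0r_neq0//; lra_from M0.
  by have /andP[_ h] := uMb _ (s0T x'); lra_from h h3 mM.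
- move=> x' t' /andP[h1 h2] xr; apply: le_trans (phige x' t' h1).
  have : closed_slab T (x', t').
    by apply/closed_slabP/andP; split=> /=; lra_from s00 h1 h2.
  move=> /uMb/andP[_ uM'].
  have hr : r <= enorm (x' - y) `^ p.
    apply: le_trans (_ : enorm (x' - y) `^ 1 <= _).
      by rewrite powRr1 ?enorm_ge0// ltW.
    by apply: ler_powR; [lra_from xr r1|exact: ltW].
  have hT : T1 `^ (1 - p) <= (t' - s0 + e) `^ (1 - p).
    apply: le_powRN; [by rewrite subr_le0 ltW|by lra_from h1 e0|].
    by rewrite /T1; lra_from s00 h1 h2 ed tT st.
  have : c * r <= C * (enorm (x' - y) `^ p * (t' - s0 + e) `^ (1 - p)).
    rewrite /c -mulrA ler_wpM2l ?(ltW C0)// mulrC; apply: ler_pM => //.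
      exact: le_trans ler01 r1.
    exact: powR_ge0.
  have -> : c * r = c + 2 * M by rewrite /r; field; rewrite lt0r_neq0.
  by move=> h; lra_from h mM uM' c0.
- move=> x' t' /andP[h1 h2] _.
  have te : s0 - e < t' by lra_from h1 e0.
  set sg := t' - s0 + e; have sg0 : 0 < sg by rewrite /sg; lra_from h1 e0.
  set S := dotv (x' - y) (x' - y) + sg.
  set D := enorm (x' - y); have D0 : 0 <= D := enorm_ge0 _.
  exists (C * (p / 2) * sg `^ (- (p / 2))),
    ((C * p * S `^ (p / 2 - 1) * sg `^ (1 - p)) *: (x' - y)),
    (C * (p / 2 * S `^ (p / 2 - 1) * sg `^ (1 - p) +
          (1 - p) * S `^ (p / 2) * sg `^ (- p))
     + C' * (1 - p / 2) * sg `^ (- (p / 2)) + 2 * delta); split.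
  + apply: mulr_ge0; last exact: powR_ge0.
    by rewrite mulr_ge0 ?divr_ge0 ?(ltW C0).
  + exact: is_derive_singular_barrier_time.
  + by move=> v; exact: is_derive_singular_barrier_space.
  + move=> v; apply: singular_barrier_second_order => //; first exact: ltW.
    by rewrite p1 p2.
  + rewrite enormZ ger0_norm; last first.
      apply: mulr_ge0; last exact: powR_ge0.
      apply: mulr_ge0; last exact: powR_ge0.
      by apply: mulr_ge0 => //; exact: ltW.
    have SE : S = D ^+ 2 + sg by rewrite /S /D enorm_sqr.
    have := barrier_inequality p1 p2 q2 pq d1 D0 sg0 SE (erefl C).
    have -> : C' * (1 - p / 2) = C * (delta + 2).
      by rewrite /C' divfK// lt0r_neq0//; lra_from p2.
    by clear; lra.
- by rewrite (ltW st).
Qed.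

Lemma subsolution_growth (R : realType) (N : nat) (q p delta T M s0 t : R)
    (u : 'rV[R]_N * R -> R) (x y : 'rV[R]_N) :
  1 < p -> p < 2 -> 2 < q -> (p - 1) * q = p -> 1 <= delta ->
  {within closed_slab T, continuous u} ->
  (forall z, closed_slab T z -> `|u z| <= M) ->
  viscosity_subsolution (F_sub q delta) T u ->
  0 <= s0 -> s0 < t -> t < T -> t - s0 <= 1 ->
  u (x, t) <= u (y, s0) + growth_constant p delta *
    (enorm (x - y) `^ p * (t - s0) `^ (1 - p) + (t - s0) `^ (1 - p / 2)).
Proof.
move=> p1 p2 q2 pq d1 cu uM usub s00 st tT t1.
set d := t - s0 in t1 *; have d0 : 0 < d by rewrite subr_gt0.
set D := enorm (x - y); have D0 : 0 <= D := enorm_ge0 _.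
apply/ler_addgt0Pr => k k0.
have [e /andP[e0 ed] h] :=
  subsolution_below_barrier x y p1 p2 q2 pq d1 cu uM usub s00 st tT k0.
rewrite -/d in ed; apply: le_trans h _; rewrite /singular_barrier /= -/d -enorm_sqr -/D.
set C' := _ / (1 - p / 2).
have C'0 : 0 <= C'.
  by rewrite /C'; apply: divr_ge0; [apply: mulr_ge0; lra_from d1|lra_from p2].
have h1 : (D ^+ 2 + (d + e)) `^ (p / 2) <= 4 * (D `^ p + d `^ (p / 2)).
  apply: le_trans (_ : 2 * ((D ^+ 2) `^ (p / 2) + (d + e) `^ (p / 2)) <= _).
    apply: powR_add_le; [|exact: sqr_ge0|by lra_from d0 e0].
    by apply/andP; split; lra_from p1 p2.
  rewrite sqr_powR_half//.
  have h1 : (d + e) `^ (p / 2) <= (2 * d) `^ (p / 2).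
    by apply: le_powR; [lra_from p1|lra_from d0 e0|lra_from ed].
  rewrite powRM ?(ltW d0)// in h1.
  have h2 : 2 `^ (p / 2) * d `^ (p / 2) <= 2 * d `^ (p / 2).
    by rewrite ler_wpM2r ?powR_ge0// powR2_le//; lra_from p2.
  by have h3 := powR_ge0 D p; lra_from h1 h2 h3.
have h2 : (d + e) `^ (1 - p) <= d `^ (1 - p).
  by apply: le_powRN; rewrite ?subr_le0 ?(ltW p1)// lerDl ltW.
have h3 : (d + e) `^ (1 - p / 2) <= 2 * d `^ (1 - p / 2).
  apply: le_trans (_ : (2 * d) `^ (1 - p / 2) <= _); first by apply: le_powR; [lra_from p2|lra_from d0 e0|lra_from ed].
  by rewrite powRM ?(ltW d0)// ler_wpM2r ?powR_ge0// powR2_le//; lra_from p1.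
have h4 : d + e <= 2 * d `^ (1 - p / 2).
  have : d `^ 1 <= d `^ (1 - p / 2) by apply: ger_powR; [rewrite d0|lra_from p1].
  by rewrite powRr1 ?(ltW d0)// => h; lra_from h ed.
have h5 : (D ^+ 2 + (d + e)) `^ (p / 2) * (d + e) `^ (1 - p) <=
    4 * (D `^ p * d `^ (1 - p) + d `^ (1 - p / 2)).
  apply: le_trans (_ : 4 * (D `^ p + d `^ (p / 2)) * d `^ (1 - p) <= _).
    by apply: ler_pM => //; exact: powR_ge0.
  have -> : d `^ (1 - p / 2) = d `^ (p / 2) * d `^ (1 - p).
    by rewrite -powRDge0//; congr (_ `^ _); field.
  by clear; lra.
have Z0 : 0 <= D `^ p * d `^ (1 - p) by rewrite mulr_ge0 ?powR_ge0.
move: h5 h3; set Q := _ * (d + e) `^ (1 - p); set W := (d + e) `^ (1 - p / 2).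
set Z := D `^ p * _ in Z0 *; set X := d `^ (1 - p / 2) in h4 * => h5 h3.
have h5' := ler_wpM2l (_ : 0 <= 4 * delta) h5.
have h3' := ler_wpM2l C'0 h3.
have h4' := ler_wpM2l (_ : 0 <= 2 * delta) h4.
have d4 : 0 <= 4 * delta by lra_from d1.
have d2 : 0 <= 2 * delta by lra_from d1.
have := h5' d4; have := h4' d2; move: h3'.
have CZ : 0 <= C' * Z by rewrite mulr_ge0.
have dZ : 0 <= delta * Z by rewrite mulr_ge0//; lra_from d1.
by rewrite /growth_constant -/C'; move: CZ dZ; clear; lra.
Qed.

(** * Oscillation decay *)

Section IntrinsicCylinders.
Variables (R : realType) (N : nat) (q alpha kappa K : R).
Variables (u : 'rV[R]_N * R -> R) (x0 : 'rV[R]_N) (t0 : R).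

Definition window (r : R) : R := K `^ (1 - q) * r `^ kappa.

(** The top is excluded because the growth estimate holds only before T. The condition [0 <= z.2]
    allows arbitrarily large radii, whose windows reach below time 0. *)
Definition cylinder (r : R) : set ('rV[R]_N * R) :=
  [set z | [/\ enorm (z.1 - x0) <= r, t0 - window r <= z.2 < t0 & 0 <= z.2]].

Definition osc_bound (r : R) : Prop :=
  forall z z', cylinder r z -> cylinder r z' -> u z - u z' <= K * r `^ alpha.

End IntrinsicCylinders.

Section Window.
Variables (R : realType).

Lemma window_gt0 (q kappa K r : R) : 0 < K -> 0 < r -> 0 < window q kappa K r.
Proof. by move=> K0 r0; rewrite mulr_gt0// powR_gt0. Qed.

Lemma window_mono (q kappa K r r' : R) : 0 <= kappa -> 0 <= r -> r <= r' ->
  window q kappa K r <= window q kappa K r'.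
Proof. by move=> k0 r0 rr; rewrite ler_wpM2l ?powR_ge0// le_powR. Qed.

Lemma window_le (q kappa K r : R) : 2 <= q -> 2 <= kappa -> 1 <= K -> 0 < r -> r <= 1 ->
  window q kappa K r <= r ^+ 2 / K.
Proof.
move=> q2 k2 K1 r0 r1; rewrite /window mulrC; apply: ler_pM; rewrite ?powR_ge0//.
  by rewrite -powR_mulrn ?(ltW r0)//; apply: ger_powR; [rewrite r0 r1|].
by rewrite -powR_inv1; [apply: ler_powR; lra|lra].
Qed.

(** Points of the smaller cylinder are at least half a window above the bottom of the larger one,
    where the singular power of the elapsed time is under control. *)
Lemma window_half (q kappa K r lam : R) : 1 <= kappa -> 0 < r -> 0 < lam -> lam <= 2^-1 ->
  window q kappa K (lam * r) <= window q kappa K r / 2.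
Proof.
move=> k1 r0 l0 l1; rewrite /window powRM ?(ltW r0) ?(ltW l0)// -mulrA.
rewrite ler_wpM2l ?powR_ge0// mulrC ler_wpM2l ?powR_ge0//.
have l2 : lam <= 1 by lra.
by apply: le_trans l1; apply: ge1r_powR => //; rewrite l0 l2.
Qed.

(** Makes the kernel term r^p [window]^(1-p) of the growth estimate equal to the oscillation K
    r^alpha. *)
Lemma window_powR (p q alpha kappa K r : R) : 0 < K -> 0 < r ->
  (p - 1) * q = p -> kappa = alpha + (1 - alpha) * q ->
  window q kappa K r `^ (1 - p) = K * r `^ (alpha - p).
Proof.
move=> K0 r0 pq ->; rewrite /window powRM ?powR_ge0// -!powRrM.
have -> : (1 - q) * (1 - p) = 1 by rewrite -[RHS]addr0 -(subrr p) -{2}pq; ring.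
have -> : (alpha + (1 - alpha) * q) * (1 - p) = alpha - p.
  have : (1 - alpha) * ((p - 1) * q - p) = 0 by rewrite pq subrr mulr0.
  by move=> h; lra.
by rewrite powRr1 ?(ltW K0).
Qed.

(** Scale invariance of the gradient term: slopes X K r^(alpha-1), raised to the power q over a full
    window, amount to X^q times the oscillation, whatever K and r. *)
Lemma window_gradient (q alpha kappa K r X : R) : 0 < K -> 0 < r -> 0 <= X ->
  kappa = alpha + (1 - alpha) * q ->
  (X * (K * r `^ (alpha - 1))) `^ q * window q kappa K r = X `^ q * (K * r `^ alpha).
Proof.
move=> K0 r0 X0 ->; rewrite /window.
rewrite powRM ?mulr_ge0 ?powR_ge0 ?(ltW K0)// powRM ?powR_ge0 ?(ltW K0)//.
rewrite -powRrM -!mulrA; congr (_ * _).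
rewrite [X in _ * X]mulrCA [LHS]mulrA -(powRDge0 q (1 - q) K0).
have -> : q + (1 - q) = 1 by ring.
rewrite powRr1 ?(ltW K0)// -powRDge0//.
by congr (_ * _ `^ _); ring.
Qed.

End Window.

(** * Lowering the maximum *)

Section OscillationStep.
Variables (R : realType) (N : nat).

(** The left out quantity decreases in alpha, and at alpha = 2 - p it is 2 - p + (p - 1) q = 2. *)
Lemma kappa_ge2 (p q alpha : R) : 1 < p -> 2 < q -> (p - 1) * q = p ->
  alpha <= 2 - p -> 2 <= alpha + (1 - alpha) * q.
Proof.
move=> p1 q2 pq ap.
have : 0 <= (2 - p - alpha) * (q - 1) by apply: mulr_ge0; lra.
have : (2 - p) * (q - 1) = q - 2 by lra.
lra.
Qed.

(** The growth estimate is applied from (y, s0), with elapsed time between half a window and a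
    window. The choice of eps makes the kernel term at most 1/16 of the oscillation, K >= 8 C1 makes
    the other at most 1/8, and 1/4 + 1/16 + 1/8 < 1/2. *)
Lemma oscillation_upper (q p delta T M alpha K eps r m t0 : R)
    (u : 'rV[R]_N * R -> R) (x0 y : 'rV[R]_N) :
  let kappa := alpha + (1 - alpha) * q in
  let C1 := growth_constant p delta in
  let s0 := t0 - window q kappa K r in
  1 < p -> p < 2 -> 2 < q -> (p - 1) * q = p -> 1 <= delta ->
  {within closed_slab T, continuous u} ->
  (forall z, closed_slab T z -> `|u z| <= M) ->
  viscosity_subsolution (F_sub q delta) T u ->
  0 < alpha -> alpha <= 2 - p -> 1 <= K -> 8 * C1 <= K -> eps = (64 * C1)^-1 ->
  0 < r -> r <= 1 -> t0 <= T -> 0 <= s0 ->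
  enorm (y - x0) <= eps * r -> u (y, s0) <= m + K * r `^ alpha / 4 ->
  forall z, cylinder q kappa K x0 t0 (eps / 2 * r) z ->
    u z <= m + K * r `^ alpha / 2.
Proof.
move=> kappa C1 s0 p1 p2 q2 pq d1 cu uM usub a0 ap K1 KC epsE r0 r1 t0T s00 yx ym.
move=> [x t] [/= xx0 /andP[tl tt0] _].
have C11 : 1 <= C1 by exact: growth_constant_ge1.
have K0 : 0 < K by exact: lt_le_trans ltr01 K1.
have C10 : 0 < 64 * C1 by lra_from C11.
have e0 : 0 < eps by rewrite epsE invr_gt0.
have eC : eps * (64 * C1) = 1 by rewrite epsE mulVf// lt0r_neq0.
have e1 : eps <= 64^-1 by rewrite epsE lef_pV2 ?posrE//; lra_from C11.
have k2 : 2 <= kappa by exact: kappa_ge2 p1 q2 pq ap.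
set d := window q kappa K r in s0 s00 ym *.
have d0 : 0 < d by exact: window_gt0.
have dhalf : window q kappa K (eps / 2 * r) <= d / 2.
  by apply: window_half => //; [lra_from k2|lra_from e0|lra_from e1].
have dr : d <= r ^+ 2 / K by apply: window_le => //; exact: ltW.
have dr2 : d <= r ^+ 2.
  by apply: le_trans dr _; rewrite ler_pdivrMr// ler_peMr ?sqr_ge0.
have d_le1 : d <= 1 by apply: le_trans dr2 _; rewrite exprn_ile1// ltW.
have dlo : d / 2 <= t - s0 by rewrite /s0; lra_from tl dhalf.
have dhi : t - s0 <= d by rewrite /s0; lra_from tt0.
have st : s0 < t by rewrite -subr_gt0; exact: lt_le_trans (divr_gt0 d0 (ltr0Sn _ 1)) dlo.
have := subsolution_growth x y p1 p2 q2 pq d1 cu uM usub s00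
  st (lt_le_trans tt0 t0T) (le_trans dhi d_le1).
rewrite -/C1.
set d' := t - s0 in dlo dhi *; set D := enorm (x - y).
have D0 : 0 <= D := enorm_ge0 _.
set om := K * r `^ alpha in ym *.
have om0 : 0 <= om by rewrite mulr_ge0 ?powR_ge0 ?(ltW K0).
have Dr : D <= 2 * eps * r.
  have er0 : 0 <= eps * r by rewrite mulr_ge0 ?(ltW e0) ?(ltW r0).
  rewrite enorm_le; last by rewrite -mulrA mulr_ge0.
  have -> : x - y = (x - x0) + (x0 - y) by rewrite addrA subrK.
  apply: le_trans (dotvv_add_le _ _) _.
  have : dotv (x0 - y) (x0 - y) <= (eps * r) ^+ 2.
    by rewrite -enorm_le// -enormN opprB.
  have : dotv (x - x0) (x - x0) <= (eps * r) ^+ 2.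
    by rewrite -enorm_le//; apply: le_trans xx0 _; lra_from er0.
  have -> : (2 * eps * r) ^+ 2 = 4 * (eps * r) ^+ 2 by ring.
  by clear; lra.
(* The factor is 2 eps, from (2 eps)^p with p > 1, times 2, from (1/2)^(1-p) with p < 2. *)
have h1 : D `^ p * d' `^ (1 - p) <= 4 * eps * om.
  apply: le_trans (_ : (2 * eps * r `^ p) * (2 * (K * r `^ (alpha - p))) <= _); last first.
    have -> : om = r `^ p * (K * r `^ (alpha - p)).
      by rewrite mulrCA -powRDge0// /om; congr (_ * _ `^ _); ring.
    by clear; lra.
  apply: ler_pM; rewrite ?powR_ge0//.
    apply: le_trans (_ : (2 * eps * r) `^ p <= _); first by apply: le_powR => //; lra_from p1.
    rewrite powRM ?(ltW r0) ?mulr_ge0 ?(ltW e0)// ler_wpM2r ?powR_ge0//.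
    by apply: ge1r_powR; [apply/andP; split; [lra_from e0|lra_from e1]|exact: ltW].
  apply: le_trans (_ : (d / 2) `^ (1 - p) <= _); first by apply: le_powRN; [lra_from p1|lra_from d0|].
  rewrite powRM ?(ltW d0)// (window_powR K0 r0 pq (erefl kappa)) mulrC ler_wpM2r//.
    by rewrite mulr_ge0 ?powR_ge0 ?(ltW K0).
  apply: le_trans (_ : 2^-1 `^ (-1) <= _); last by rewrite powR_inv1 ?invrK.
  by apply: ger_powR; [apply/andP; split; clear; lra|lra_from p2].
(* From d' <= r^2, as r^(2-p) <= r^alpha for alpha <= 2 - p and r <= 1. *)
have h2 : d' `^ (1 - p / 2) <= r `^ alpha.
  apply: le_trans (_ : (r ^+ 2) `^ (1 - p / 2) <= _); first by apply: le_powR; [lra_from p2|lra_from dlo d0|exact: le_trans dr2].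
  rewrite -powR_mulrn ?(ltW r0)// -powRrM; apply: ger_powR; first by rewrite r0 r1.
  by lra_from ap.
have h3 : C1 * (D `^ p * d' `^ (1 - p)) <= om / 16.
  apply: le_trans (ler_wpM2l (_ : 0 <= C1) h1) _; first by lra_from C11.
  have -> : C1 * (4 * eps * om) = eps * (64 * C1) * om / 16 by field.
  by rewrite eC mul1r.
have h4 : C1 * d' `^ (1 - p / 2) <= om / 8.
  apply: le_trans (ler_wpM2l (_ : 0 <= C1) h2) _; first by lra_from C11.
  rewrite /om mulrAC ler_wpM2r ?powR_ge0//; lra_from KC.
move=> h; lra_from h h3 h4 ym om0.
Qed.

End OscillationStep.

(** * Raising the minimum *)

Section OscillationDecay.
Variables (R : realType).

(** Each of the three terms costs at most eta om / 16. The second order one gains 1/K from d <= r^2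
    / K, the constant one from r^alpha = om / K. The gradient term has no such gain and is small
    because (2 eta / eps)^q <= (2 eta / eps)^2 = eta / (16 delta), which dictates eta = eps^2 / (64
    delta). *)
Lemma paraboloid_loss_le (q alpha delta eps eta K r A d om : R) :
  let kappa := alpha + (1 - alpha) * q in
  2 < q -> 0 < delta -> 0 < eps -> 0 < eta ->
  eta * (64 * delta) = eps ^+ 2 -> 2 * eta <= eps -> alpha <= 1 ->
  1 <= K -> 16 * delta <= K * eps ^+ 2 -> 16 * delta <= K * eta ->
  0 < r -> r <= 1 -> d = window q kappa K r -> d <= r ^+ 2 / K ->
  om = K * r `^ alpha -> 0 < om -> A = eta * om / (eps ^+ 2 * r ^+ 2) ->
  (delta * A + delta * (2 * A * (eps * r)) `^ q + delta) * d <= 3 / 16 * (eta * om).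
Proof.
move=> kappa q2 d0 e0 eta0 etad etae a1 K1 Ke Keta r0 r1 dE dr omE om0 AE'.
have K0 : 0 < K by exact: lt_le_trans ltr01 K1.
have q0 : 0 < q by lra_from q2.
have e20 : 0 < eps ^+ 2 by rewrite exprn_gt0.
have r20 : 0 < r ^+ 2 by rewrite exprn_gt0.
have er0 : 0 < eps ^+ 2 * r ^+ 2 by rewrite mulr_gt0.
have A0 : 0 < A by rewrite AE' divr_gt0 ?mulr_gt0.
have AE : A * (eps ^+ 2 * r ^+ 2) = eta * om by rewrite AE' divfK// lt0r_neq0.
have X0 : 0 < 2 * eta / eps by rewrite divr_gt0 ?mulr_gt0.
have c1 : delta * A * d <= eta * om / 16.
  apply: le_trans (ler_wpM2l (ltW (mulr_gt0 d0 A0)) dr) _.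
  rewrite mulrA ler_pdivrMr// -AE.
  have := ler_wpM2l (ltW (mulr_gt0 A0 r20)) Ke; clear; lra.
have c2 : delta * (2 * A * (eps * r)) `^ q * d <= eta * om / 16.
  have -> : 2 * A * (eps * r) = (2 * eta / eps) * (K * r `^ (alpha - 1)).
    rewrite powRB ?(gt_eqF r0) ?implybT// powRr1 ?(ltW r0)// AE' omE.
    by field; rewrite !lt0r_neq0.
  rewrite -mulrA dE window_gradient ?(ltW X0)// -omE.
  have X1 : 2 * eta / eps <= 1 by rewrite ler_pdivrMr// mul1r.
  have Xq : (2 * eta / eps) `^ q <= (2 * eta / eps) ^+ 2.
    by rewrite -powR_mulrn ?(ltW X0)//; apply: ger_powR; [rewrite X0|exact: ltW].
  have X2 : (2 * eta / eps) ^+ 2 = eta / (16 * delta).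
    have -> : (2 * eta / eps) ^+ 2 = 4 * eta ^+ 2 / eps ^+ 2.
      by field; rewrite lt0r_neq0.
    by rewrite -etad; field; rewrite !lt0r_neq0.
  rewrite mulrA; have -> : eta * om / 16 = delta * (eta / (16 * delta)) * om.
    by field; rewrite lt0r_neq0.
  by rewrite ler_wpM2r ?(ltW om0)// ler_wpM2l ?(ltW d0)// -X2.
have c3 : delta * d <= eta * om / 16.
  have h2 : d <= r `^ alpha.
    apply: le_trans dr _; apply: le_trans (_ : r ^+ 2 <= _).
      by rewrite ler_pdivrMr// ler_peMr ?sqr_ge0.
    rewrite -powR_mulrn ?(ltW r0)//; apply: ger_powR; [by rewrite r0|lra_from a1].
  have h3 := ler_wpM2r (powR_ge0 r alpha) Keta.
  have h4 := ler_wpM2l (ltW d0) h2.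
  rewrite omE; lra_from h3 h4.
lra_from c1 c2 c3.
Qed.

(** Both sides are compared with affine functions equal at z = 1: by Bernoulli the left one has
    slope at most alpha om, the right one at least eta om. *)
Lemma growth_below_paraboloid (alpha eta eps om z : R) :
  0 < alpha -> alpha < 1 -> alpha <= eta -> 0 < eps -> eps <= 1 -> 0 <= om -> 1 <= z ->
  eta * om + om * z `^ alpha <= om + eta * om * (z ^+ 2 / eps ^+ 2).
Proof.
move=> a0 a1 aeta e0 e1 om0 z1.
have z0 : 0 <= z by exact: le_trans ler01 z1.
have a01 : 0 < alpha < 1 by rewrite a0 a1.
have eta0 : 0 <= eta by apply: le_trans aeta; exact: ltW.
have zb := ler_wpM2l om0 (powR_bernoulli z0 a01).
have h6 : 0 <= om * ((eta - alpha) * (z - 1)).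
  by rewrite mulr_ge0// mulr_ge0// subr_ge0.
have h7 : 0 <= eta * om * (z ^+ 2 / eps ^+ 2 - z).
  rewrite mulr_ge0 ?mulr_ge0// subr_ge0 ler_pdivlMr ?exprn_gt0//.
  apply: le_trans (_ : z * 1 <= _); last by rewrite expr2 ler_wpM2l.
  by rewrite ler_wpM2l// exprn_ile1// ltW.
lra_from zb h6 h7.
Qed.

Lemma eta_bounds (delta eps eta : R) :
  1 <= delta -> 0 < eps -> eps <= 2^-1 -> eta = eps ^+ 2 / (64 * delta) ->
  [/\ 0 < eta, eta <= 4^-1, 2 * eta <= eps & eta * (64 * delta) = eps ^+ 2].
Proof.
move=> d1 e0 e1 etaE.
have d0 : 0 < 64 * delta by lra_from d1.
have eta0 : 0 < eta by rewrite etaE divr_gt0 ?exprn_gt0.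
have etad : eta * (64 * delta) = eps ^+ 2 by rewrite etaE divfK// lt0r_neq0.
have h1 : eta * 64 <= eps ^+ 2.
  by rewrite -etad; apply: ler_wpM2l; [exact: ltW|lra_from d1].
have h2 : eps ^+ 2 <= eps * 2^-1 by rewrite expr2 ler_wpM2l ?(ltW e0).
by split=> //; lra_from h1 h2 e1 e0 eta0.
Qed.

Variable N : nat.

(** Between eps r and r the paraboloid has dropped to m or below, while u >= m. Beyond r, the bound
    on the cylinder of radius |x - x0| lets u fall only like K |x - x0|^alpha, which the paraboloid
    outruns. *)
Lemma paraboloid_below_far (q alpha kappa K eps eta r m t0 A om : R)
    (u : 'rV[R]_N * R -> R) (x0 x : 'rV[R]_N) (t : R) :
  0 <= kappa -> 0 < alpha -> alpha < 1 -> alpha <= eta -> 0 < eps -> eps <= 1 ->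
  0 < r -> om = K * r `^ alpha -> 0 < om ->
  A * (eps ^+ 2 * r ^+ 2) = eta * om -> 0 < A ->
  (forall X z, r <= X -> cylinder q kappa K x0 t0 X z ->
    m + om <= u z + K * X `^ alpha) ->
  t0 - window q kappa K r <= t < t0 -> 0 <= t -> eps * r < enorm (x - x0) ->
  m + eta * om - A * dotv (x - x0) (x - x0) <= u (x, t).
Proof.
move=> k0 a0 a1 aeta e0 e1 r0 omE om0 AE A0 far /andP[h1 h2] t00.
rewrite -enorm_sqr; set X := enorm _ => h3.
have X0 : 0 < X by apply: lt_trans h3; rewrite mulr_gt0.
have [Xr|/ltW rX] := leP X r.
  have h : m + om <= u (x, t) + om.
    by rewrite {2}omE; apply: far => //; split=> //=; rewrite h1.
  have : A * (eps ^+ 2 * r ^+ 2) <= A * X ^+ 2.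
    rewrite ler_wpM2l ?(ltW A0)// -exprMn lerXn2r ?nnegrE ?(ltW X0)//.
      by rewrite mulr_ge0 ?(ltW e0) ?(ltW r0).
    exact: ltW.
  by rewrite AE; lra_from h.
have inX : cylinder q kappa K x0 t0 X (x, t).
  split=> //=; rewrite h2 andbT; apply: le_trans h1; rewrite lerB//.
  by apply: window_mono => //; exact: ltW.
have := far X (x, t) rX inX.
have z1 : 1 <= X / r by rewrite ler_pdivlMr// mul1r.
have AX : A * X ^+ 2 = eta * om * ((X / r) ^+ 2 / eps ^+ 2).
  by rewrite -AE; field; rewrite !lt0r_neq0.
have -> : K * X `^ alpha = om * (X / r) `^ alpha.
  rewrite omE -mulrA -powRM ?(ltW r0) ?(le_trans ler01 z1)//.
  by rewrite mulrC [r * _]mulrC divfK ?lt0r_neq0// mulrC.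
have := growth_below_paraboloid a0 a1 aeta e0 e1 (ltW om0) z1.
by rewrite AX; clear; lra.
Qed.

(** Of the height eta om of the paraboloid, at most 1/4 is lost in space inside the small cylinder
    and 3/16 in time, so more than half is left. *)
Lemma oscillation_lower (q p delta T M alpha K eps eta r m t0 : R)
    (u : 'rV[R]_N * R -> R) (x0 : 'rV[R]_N) :
  let kappa := alpha + (1 - alpha) * q in
  let s0 := t0 - window q kappa K r in
  1 < p -> p < 2 -> 2 < q -> (p - 1) * q = p -> 1 <= delta ->
  {within closed_slab T, continuous u} ->
  (forall z, closed_slab T z -> `|u z| <= M) ->
  viscosity_supersolution (F_super q delta) T u ->
  0 < alpha -> alpha <= 2 - p -> alpha <= eta ->
  0 < eps -> eps <= 2^-1 -> eta = eps ^+ 2 / (64 * delta) ->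
  1 <= K -> 16 * delta / eps ^+ 2 <= K -> 16 * delta / eta <= K ->
  0 < r -> r <= 1 -> t0 <= T -> 0 <= s0 ->
  (forall X z, r <= X -> cylinder q kappa K x0 t0 X z ->
    m + K * r `^ alpha <= u z + K * X `^ alpha) ->
  (forall y, enorm (y - x0) <= eps * r -> m + K * r `^ alpha / 4 < u (y, s0)) ->
  forall z, cylinder q kappa K x0 t0 (eps / 2 * r) z ->
    m + eta * (K * r `^ alpha) / 2 <= u z.
Proof.
move=> kappa s0 p1 p2 q2 pq d1 cu uM usup a0 ap aeta e0 e1 etaE K1 Ke Keta r0 r1
  t0T s00 far low [x t] [/= xx0 /andP[tl tt0] t00].
have K0 : 0 < K by exact: lt_le_trans ltr01 K1.
have k2 : 2 <= kappa by exact: kappa_ge2 p1 q2 pq ap.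
have a1 : alpha < 1 by lra_from ap p1.
have e1' : eps <= 1 by lra_from e1.
have delta0 : 0 < delta by exact: lt_le_trans ltr01 d1.
have q0 : 0 <= q by lra_from q2.
have [eta0 eta1 etae etad] := eta_bounds d1 e0 e1 etaE.
have [d dE] : exists d, d = window q kappa K r by exists (window q kappa K r).
have [om omE] : exists om, om = K * r `^ alpha by exists (K * r `^ alpha).
have dr : d <= r ^+ 2 / K by rewrite dE; apply: window_le => //; exact: ltW.
have d0 : 0 < d by rewrite dE; exact: window_gt0.
have dhalf : window q kappa K (eps / 2 * r) <= d / 2.
  by rewrite dE; apply: window_half => //; [lra_from k2|lra_from e0|lra_from e1].
have om0 : 0 < om by rewrite omE mulr_gt0 ?powR_gt0.
have er0 : 0 < eps ^+ 2 * r ^+ 2 by rewrite mulr_gt0 ?exprn_gt0.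
(* With this opening the paraboloid drops by exactly eta om at distance eps r. *)
have [A AE'] : exists A, A = eta * om / (eps ^+ 2 * r ^+ 2).
  by exists (eta * om / (eps ^+ 2 * r ^+ 2)).
have A0 : 0 < A by rewrite AE' divr_gt0 ?mulr_gt0.
have AE : A * (eps ^+ 2 * r ^+ 2) = eta * om by rewrite AE' divfK// lt0r_neq0.
have Ke' : 16 * delta <= K * eps ^+ 2 by rewrite -ler_pdivrMr ?exprn_gt0.
have Keta' : 16 * delta <= K * eta by rewrite -ler_pdivrMr.
have CBd := paraboloid_loss_le q2 delta0 e0 eta0 etad etae (ltW a1) K1 Ke' Keta' r0 r1
  dE dr omE om0 AE'.
rewrite -omE in low far *; have s0E : s0 = t0 - d by rewrite dE.
have farA x' t' : s0 <= t' < t0 -> eps * r < enorm (x' - x0) ->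
    m + eta * om - A * dotv (x' - x0) (x' - x0) <= u (x', t').
  move=> tin; apply: (paraboloid_below_far _ a0 a1 aeta e0 e1' r0 omE om0 AE A0 far tin).
    by lra_from k2.
  by case/andP: tin => h _; exact: le_trans h.
have init x' : m + eta * om - A * dotv (x' - x0) (x' - x0) <= u (x', s0).
  have [h|h] := leP (enorm (x' - x0)) (eps * r); last first.
    by apply: farA => //; rewrite lexx s0E ltrBlDr ltrDl.
  have h1 := low x' h.
  have h2 : 0 <= A * dotv (x' - x0) (x' - x0) := mulr_ge0 (ltW A0) (dotvv_ge0 _).
  have h3 : eta * om <= 4^-1 * om by rewrite ler_wpM2r ?(ltW om0).
  by lra_from h1 h2 h3.
have tin : s0 <= t < t0 by rewrite tt0 andbT s0E; lra_from tl dhalf d0.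
have h := quadratic_lower_bound s00 t0T (ltW delta0) (ltW A0) q0 cu uM usup init farA
  (lexx _) x tin.
have h1 : A * dotv (x - x0) (x - x0) <= eta * om / 4.
  have : dotv (x - x0) (x - x0) <= (eps / 2 * r) ^+ 2.
    by rewrite -enorm_le// mulr_ge0 ?(ltW r0) ?divr_ge0 ?(ltW e0).
  move=> /(ler_wpM2l (ltW A0)).
  have -> : A * (eps / 2 * r) ^+ 2 = A * (eps ^+ 2 * r ^+ 2) / 4 by field.
  by rewrite AE.
move: h CBd; set CB := _ + delta => h CBd.
have CB0 : 0 <= CB.
  by rewrite /CB !addr_ge0 ?(ltW delta0)// mulr_ge0 ?(ltW delta0) ?(ltW A0) ?powR_ge0.
have h2 : CB * (t - s0) <= CB * d.
  by rewrite ler_wpM2l// s0E; lra_from tt0.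
move: h h1 h2 CBd (mulr_gt0 eta0 om0); clear; lra.
Qed.

End OscillationDecay.

(** Bernoulli at 1 / lam gives lam^(-alpha) <= 1 + eta / 2, and (1 + eta / 2)^(-1) >= 1 - eta / 2. A
    gain of eta / 2 in oscillation thus pays for shrinking the radius by lam. *)
Lemma powR_contraction (R : realType) (lam alpha eta : R) :
  0 < lam -> lam <= 1 -> 0 < alpha -> alpha < 1 -> alpha <= eta * lam / 2 ->
  1 - eta / 2 <= lam `^ alpha.
Proof.
move=> l0 l1 a0 a1 al.
have lV0 : 0 < lam^-1 by rewrite invr_gt0.
have := @powR_bernoulli R lam^-1 alpha (ltW lV0) ltac:(by apply/andP).
have : alpha * lam^-1 <= eta / 2 by rewrite ler_pdivrMr// mulrAC.
have E : lam `^ alpha * lam^-1 `^ alpha = 1.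
  by rewrite -powRM ?(ltW l0) ?(ltW lV0)// mulfV ?lt0r_neq0// powR1.
set x := lam `^ alpha in E *; set y := lam^-1 `^ alpha in E * => h1 h2.
have x0 : 0 < x by exact: powR_gt0.
have h3 : 0 <= x * (1 + eta / 2 - y) by rewrite mulr_ge0 ?(ltW x0)//; lra.
have [xe|/ltW xe] := leP (1 - eta / 2) x; first by [].
have e0 : 0 <= eta.
  have : 0 < eta * lam by lra.
  by rewrite pmulr_lgt0// => /ltW.
have : 0 <= (1 - eta / 2 - x) * (1 + eta / 2) by rewrite mulr_ge0//; lra.
have := sqr_ge0 eta.
nra.
Qed.

(** * Iteration of the dichotomy *)

Section OscillationIteration.
Variables (R : realType) (N : nat).

Lemma oscillation_step (q p delta T M alpha K eps eta r t0 : R)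
    (u : 'rV[R]_N * R -> R) (x0 : 'rV[R]_N) :
  let kappa := alpha + (1 - alpha) * q in
  let C1 := growth_constant p delta in
  1 < p -> p < 2 -> 2 < q -> (p - 1) * q = p -> 1 <= delta ->
  {within closed_slab T, continuous u} ->
  (forall z, closed_slab T z -> `|u z| <= M) ->
  viscosity_supersolution (F_super q delta) T u ->
  viscosity_subsolution (F_sub q delta) T u ->
  eps = (64 * C1)^-1 -> eta = eps ^+ 2 / (64 * delta) ->
  0 < alpha -> alpha <= 2 - p -> alpha <= eta * (eps / 2) / 2 ->
  1 <= K -> 8 * C1 <= K -> 16 * delta / eps ^+ 2 <= K -> 16 * delta / eta <= K ->
  0 < r -> r <= 1 -> t0 <= T -> 0 <= t0 - window q kappa K r ->
  (forall X, r <= X -> osc_bound q alpha kappa K u x0 t0 X) ->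
  osc_bound q alpha kappa K u x0 t0 (eps / 2 * r).
Proof.
move=> kappa C1 p1 p2 q2 pq d1 cu uM usup usub epsE etaE a0 ap al K1 KC Ke Keta
  r0 r1 t0T s00 osc.
have K0 : 0 < K by exact: lt_le_trans ltr01 K1.
have C11 : 1 <= C1 by exact: growth_constant_ge1.
have C10 : 0 < 64 * C1 by lra_from C11.
have e0 : 0 < eps by rewrite epsE invr_gt0.
have e1 : eps <= 64^-1 by rewrite epsE lef_pV2 ?posrE//; lra_from C11.
have e1' : eps <= 2^-1 by apply: le_trans e1 _; rewrite lef_pV2 ?posrE ?ler_nat.
have [eta0 eta1 _ _] := eta_bounds d1 e0 e1' etaE.
have eta2 : eta <= 1 by lra_from eta1.
have aeta : alpha <= eta.
  by apply: le_trans al _; rewrite -mulrA ler_piMr ?(ltW eta0)//; lra_from e1.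
have k2 : 2 <= kappa by exact: kappa_ge2 p1 q2 pq ap.
have k0 : 0 <= kappa by lra_from k2.
have a1 : alpha < 1 by lra_from ap p1.
set d := window q kappa K r in s00 *.
have d0 : 0 < d by exact: window_gt0.
set om := K * r `^ alpha.
have om0 : 0 < om by rewrite mulr_gt0 ?powR_gt0.
(* With this choice, rather than the infimum of u, the bound u >= m + om - K X^alpha
   holds on every larger cylinder of radius X. *)
pose m := sup (u @` cylinder q kappa K x0 t0 r) - om.
have uMc z X : cylinder q kappa K x0 t0 X z -> - M <= u z <= M.
  move=> [_ /andP[_ zt] z0]; have : closed_slab T z.
    by apply/closed_slabP; rewrite z0 (le_trans (ltW zt)).
  by move=> /uM; rewrite ler_norml.
have Q0 : cylinder q kappa K x0 t0 r (x0, t0 - d).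
  split=> //=; last by rewrite lexx ltrBlDr ltrDl.
  by rewrite subrr enorm_le ?(ltW r0)// /dotv big1 ?sqr_ge0// => i _; rewrite mxE mul0r.
have hsup : has_sup (u @` cylinder q kappa K x0 t0 r).
  split; first by exists (u (x0, t0 - d)), (x0, t0 - d).
  by exists M => _ [z Qz <-]; case/andP: (uMc _ _ Qz).
have um z : cylinder q kappa K x0 t0 r z -> u z <= m + om.
  by move=> Qz; rewrite /m subrK; apply: sup_upper_bound => //; exists z.
have cyl_mono X Y z : 0 <= X -> X <= Y -> cylinder q kappa K x0 t0 X z ->
    cylinder q kappa K x0 t0 Y z.
  move=> X0 XY [h1 /andP[h2 h3] h4]; split=> //; first exact: le_trans XY.
  rewrite h3 andbT; apply: le_trans h2; rewrite lerB//.
  exact: window_mono.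
have far X z : r <= X -> cylinder q kappa K x0 t0 X z -> m + om <= u z + K * X `^ alpha.
  move=> rX Xz; rewrite /m subrK; apply: ge_sup; first by case: hsup.
  move=> _ [z' Qz' <-]; rewrite -lerBlDl.
  by apply: (osc X rX) => //; apply: cyl_mono Qz' => //; exact: ltW.
have lamr : eps / 2 * r <= r by rewrite ler_piMl ?(ltW r0)//; lra_from e1.
have lam0 : 0 < eps / 2 by lra_from e0.
have lam1 : eps / 2 <= 1 by lra_from e1.
have lr0 : 0 <= eps / 2 * r by rewrite mulr_ge0 ?(ltW r0) ?(ltW lam0).
have contr : 1 - eta / 2 <= (eps / 2) `^ alpha by exact: powR_contraction.
have goalE : K * (eps / 2 * r) `^ alpha = (eps / 2) `^ alpha * om.
  by rewrite powRM ?(ltW lam0) ?(ltW r0)// mulrCA.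
have goal_ge : om - eta * om / 2 <= K * (eps / 2 * r) `^ alpha.
  rewrite goalE; have : 0 <= ((eps / 2) `^ alpha - (1 - eta / 2)) * om.
    by rewrite mulr_ge0 ?(ltW om0)// subr_ge0.
  clear; lra.
have eom : eta * om <= om by rewrite ler_piMl ?(ltW om0).
move=> z z' Qz Qz'.
(* In the first case the oscillation falls to om / 2, in the second to om - eta om / 2, the weaker
   gain as eta <= 1. *)
have [[y [yx uy]]|nlow] := pselect (exists y, enorm (y - x0) <= eps * r /\
    u (y, t0 - d) <= m + om / 4).
  have h := oscillation_upper p1 p2 q2 pq d1 cu uM usub a0 ap K1 KC epsE r0 r1 t0T s00
    yx uy Qz.
  have h' := far r z' (lexx r) (cyl_mono _ _ _ lr0 lamr Qz').
  by move: h h' goal_ge eom; rewrite -/om; clear; lra.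
have low y : enorm (y - x0) <= eps * r -> m + om / 4 < u (y, t0 - d).
  by move=> yx; rewrite ltNge; apply/negP => uy; apply: nlow; exists y.
have h := oscillation_lower p1 p2 q2 pq d1 cu uM usup a0 ap aeta e0 e1' etaE K1 Ke Keta
  r0 r1 t0T s00 far low Qz'.
have h' := um z (cyl_mono _ _ _ lr0 lamr Qz).
by move: h h' goal_ge; rewrite -/om; clear; lra.
Qed.

Lemma oscillation_decay (q p delta T M alpha K eps eta t0 : R)
    (u : 'rV[R]_N * R -> R) (x0 : 'rV[R]_N) :
  let kappa := alpha + (1 - alpha) * q in
  let C1 := growth_constant p delta in
  1 < p -> p < 2 -> 2 < q -> (p - 1) * q = p -> 1 <= delta ->
  {within closed_slab T, continuous u} ->
  (forall z, closed_slab T z -> `|u z| <= M) ->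
  viscosity_supersolution (F_super q delta) T u ->
  viscosity_subsolution (F_sub q delta) T u ->
  eps = (64 * C1)^-1 -> eta = eps ^+ 2 / (64 * delta) ->
  0 < alpha -> alpha <= 2 - p -> alpha <= eta * (eps / 2) / 2 ->
  1 <= K -> 8 * C1 <= K -> 16 * delta / eps ^+ 2 <= K -> 16 * delta / eta <= K ->
  4 * M <= K -> t0 <= T -> K^-1 <= t0 ->
  forall r, 0 < r -> osc_bound q alpha kappa K u x0 t0 r.
Proof.
move=> kappa C1 p1 p2 q2 pq d1 cu uM usup usub epsE etaE a0 ap al K1 KC Ke Keta KM
  t0T Kt0.
have K0 : 0 < K by exact: lt_le_trans ltr01 K1.
have C11 : 1 <= C1 by exact: growth_constant_ge1.
have C10 : 0 < 64 * C1 by lra_from C11.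
have e0 : 0 < eps by rewrite epsE invr_gt0.
have e1 : eps <= 64^-1 by rewrite epsE lef_pV2 ?posrE//; lra_from C11.
have e1' : eps <= 2^-1 by lra_from e1.
have [eta0 eta1 _ _] := eta_bounds d1 e0 e1' etaE.
have a1 : alpha < 1 by lra_from ap p1.
have k2 : 2 <= kappa by exact: kappa_ge2 p1 q2 pq ap.
set lam := eps / 2 in al.
have l0 : 0 < lam by rewrite /lam; lra_from e0.
have l2 : lam <= 1 by rewrite /lam; lra_from e1.
have l1 : lam <= 2^-1 by rewrite /lam; lra_from e1.
have contr : 1 - eta / 2 <= lam `^ alpha by exact: powR_contraction.
(* All radii from lam^(n+1) on are included because a step needs every larger cylinder. In the base
   case r >= lam, so r^alpha >= 1/2 and 2 M <= K / 2 suffices. *)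
have P n : forall r, lam ^+ n.+1 <= r -> osc_bound q alpha kappa K u x0 t0 r.
  elim: n => [|n IHn] r rn.
    move=> z z' [_ /andP[_ zt] z0] [_ /andP[_ zt'] z0'].
    have uMc y : 0 <= y.2 -> y.2 < t0 -> - M <= u y <= M.
      move=> y0 yt; have : closed_slab T y.
        by apply/closed_slabP; rewrite y0 (le_trans (ltW yt)).
      by move=> /uM; rewrite ler_norml.
    have /andP[_ h] := uMc z z0 zt; have /andP[h' _] := uMc z' z0' zt'.
    have : lam `^ alpha <= r `^ alpha.
      by apply: le_powR; [exact: ltW|exact: ltW|rewrite expr1 in rn].
    move=> ra; have h3 : 2^-1 <= r `^ alpha by lra_from ra contr eta1.
    have h4 := ler_wpM2l (ltW K0) h3.
    by lra_from h h' h4 KM.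
  have [h|/ltW h] := leP (lam ^+ n.+1) r; first exact: IHn.
  have rE : r = lam * (r / lam) by rewrite mulrC divfK// lt0r_neq0.
  have ln : lam ^+ n.+1 <= r / lam by rewrite ler_pdivlMr// -exprSr.
  have rl0 : 0 < r / lam by apply: lt_le_trans ln; rewrite exprn_gt0.
  have rl1 : r / lam <= 1.
    rewrite ler_pdivrMr// mul1r; apply: le_trans h _.
    by rewrite exprS ler_piMr ?(ltW l0)// exprn_ile1 ?(ltW l0).
  rewrite rE; apply: (oscillation_step p1 p2 q2 pq d1 cu uM usup usub epsE etaE a0 ap al
    K1 KC Ke Keta rl0 rl1 t0T).
    (* The window is at most 1 / K <= t0, so the bottom of the larger cylinder is at a nonnegative
       time. *)
    have h1 : window q kappa K (r / lam) <= (r / lam) ^+ 2 / K.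
      by apply: window_le => //; exact: ltW.
    have h2 : (r / lam) ^+ 2 / K <= K^-1.
      by rewrite ler_piMl ?invr_ge0 ?(ltW K0)// exprn_ile1// ltW.
    by rewrite subr_ge0; apply: le_trans h1 (le_trans h2 _).
  by move=> X rX; apply: IHn; exact: le_trans rX.
move=> r r0; pose n := (Num.bound r^-1).
have nr : r^-1 < 2 ^+ n.+1.
  by apply: upper_nthrootP; exact: leqW (leqnn _).
apply: (P n); apply: le_trans (_ : 2^-1 ^+ n.+1 <= _).
  by rewrite lerXn2r// ?nnegrE ?(ltW l0).
rewrite exprVn -[leRHS]invrK lef_pV2 ?posrE ?invr_gt0 ?exprn_gt0//.
exact: ltW.
Qed.

End OscillationIteration.

(** * From oscillation decay to Hölder continuity *)

Lemma osc_bound_holder (R : realType) (N : nat) (q T alpha K tau : R)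
    (u : 'rV[R]_N * R -> R) :
  let kappa := alpha + (1 - alpha) * q in
  {within closed_slab T, continuous u} ->
  1 <= q -> 0 < alpha -> alpha <= 1 -> alpha <= kappa -> 1 <= K -> 0 < tau ->
  (forall x0 t0 r, tau <= t0 <= T -> 0 < r -> osc_bound q alpha kappa K u x0 t0 r) ->
  forall x1 x2 t1 t2, tau <= t1 -> t1 <= t2 -> t2 <= T ->
    `|u (x1, t1) - u (x2, t2)| <= 4 * K * K `^ (q - 1) *
      (enorm (x1 - x2) `^ alpha + `|t1 - t2| `^ (alpha / kappa)).
Proof.
move=> kappa cu q1 a0 a1 ak K1 tau0 osc x1 x2 t1 t2 tt1 t12 t2T.
have K0 : 0 < K by exact: lt_le_trans ltr01 K1.
have k0 : 0 < kappa by exact: lt_le_trans a0 ak.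
set Dx := enorm _; have Dx0 : 0 <= Dx := enorm_ge0 _.
have -> : `|t1 - t2| = t2 - t1 by rewrite distrC ger0_norm// subr_ge0.
set Dt := t2 - t1; have Dt0 : 0 <= Dt by rewrite subr_ge0.
have KK1 : 1 <= K `^ (q - 1) by rewrite -[leLHS](powRr0 K); apply: ler_powR; rewrite ?subr_ge0.
set KK := K `^ (q - 1) in KK1 *.
(* The radius B^(1/kappa) has a window of length 2 Dt. The cylinder of radius r at (x2, t2) thus
   contains both points after a small backward shift in time, for which the factor 2 leaves room. *)
pose B := 2 * KK * Dt; have B0 : 0 <= B by rewrite mulr_ge0//; lra_from KK1.
pose r := Dx + B `^ kappa^-1.
have Br0 : 0 <= B `^ kappa^-1 := powR_ge0 _ _.
have [r0|r_le0] := ltP 0 r; last first.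
  rewrite /r in r_le0; have Dx00 : Dx = 0 by lra_from Dx0 Br0 r_le0.
  have : B `^ kappa^-1 = 0 by lra_from Dx0 Br0 r_le0.
  move=> /powR_eq0_eq0 /eqP; rewrite mulf_eq0 => /orP[/eqP|/eqP Dt00]; first by lra_from KK1.
  have -> : x1 = x2 by apply/eqP; rewrite -subr_eq0 (enorm0_eq0 Dx00).
  have -> : t1 = t2 by rewrite /Dt in Dt00; lra_from Dt00.
  by rewrite subrr normr0 mulr_ge0 ?addr_ge0 ?powR_ge0// !mulr_ge0 ?powR_ge0 ?(ltW K0).
have wr : Dt < window q kappa K r.
  have [Dtp|Dtn] := ltP 0 Dt; last by apply: le_lt_trans Dtn _; exact: window_gt0.
  have h : B <= r `^ kappa.
    have -> : B = (B `^ kappa^-1) `^ kappa.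
      by rewrite -powRrM mulVf ?powRr1// lt0r_neq0.
    by apply: le_powR => //; [exact: ltW|rewrite lerDr].
  have : K `^ (1 - q) * B <= window q kappa K r by rewrite ler_wpM2l ?powR_ge0.
  apply: lt_le_trans.
  have E : K `^ (1 - q) * KK = 1.
    by rewrite /KK -powRDge0// (_ : 1 - q + (q - 1) = 0) ?powRr0//; ring.
  have -> : K `^ (1 - q) * B = 2 * (K `^ (1 - q) * KK) * Dt by rewrite /B; ring.
  by rewrite E; lra_from Dtp.
have main : `|u (x1, t1) - u (x2, t2)| <= K * r `^ alpha.
  (* Cylinders exclude their top, so both points are moved down by a small time [s]; continuity of u
     accounts for the error e. *)
  apply/ler_addgt0Pr => e e0.
  have e20 : 0 < e / 2 by lra_from e0.
  have t10 : 0 <= t1 by exact: le_trans (ltW tau0) tt1.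
  have t1T : t1 <= T by exact: le_trans t12 t2T.
  have t2tau : tau <= t2 by exact: le_trans tt1 t12.
  have t20 : 0 <= t2 by exact: le_trans t10 t12.
  have t1in : 0 <= t1 <= T by rewrite t10.
  have t2in : 0 <= t2 <= T by rewrite t20.
  have [ra ra0 ha] := slab_continuity x1 cu t1in e20.
  have [rb rb0 hb] := slab_continuity x2 cu t2in e20.
  pose s := Num.min (Num.min ra rb) (Num.min (window q kappa K r - Dt) tau) / 2.
  have s0 : 0 < s by rewrite divr_gt0// !lt_min ra0 rb0 tau0 subr_gt0 wr.
  have : s * 2 <= Num.min (Num.min ra rb) (Num.min (window q kappa K r - Dt) tau).
    by rewrite divfK.
  rewrite !le_min => /andP[/andP[sa sb] /andP[sw stau]].
  have sn : `|s| = s by rewrite gtr0_norm.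
  have sT (t : R) : tau <= t -> t <= T -> 0 <= t - s <= T.
    by move=> h1 h2; apply/andP; split; lra_from h1 h2 s0 stau.
  have s_ra : s < ra by lra_from s0 sa.
  have s_rb : s < rb by lra_from s0 sb.
  have ua : `|u (x1, t1) - u (x1, t1 - s)| < e / 2.
    apply: ha; [exact: sT|by rewrite subrr normr0|].
    by rewrite opprB addrC subrK sn.
  have ub : `|u (x2, t2) - u (x2, t2 - s)| < e / 2.
    apply: hb; [exact: sT|by rewrite subrr normr0|].
    by rewrite opprB addrC subrK sn.
  have Qa : cylinder q kappa K x2 t2 r (x1, t1 - s).
    rewrite /Dt in sw; split=> /=; first by rewrite lerDl.
      by apply/andP; split; lra_from sw s0 t12.
    by lra_from s0 stau tt1.
  have Qb : cylinder q kappa K x2 t2 r (x2, t2 - s).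
    split=> /=.
    - have -> : x2 - x2 = 0 *: x1 by rewrite subrr scale0r.
      by rewrite enormZ normr0 mul0r ltW.
    - by apply/andP; split; lra_from sw s0 Dt0.
    - by lra_from s0 stau t2tau.
  have ot : tau <= t2 <= T by rewrite t2tau.
  have o1 := osc x2 t2 r ot r0 _ _ Qa Qb; have o2 := osc x2 t2 r ot r0 _ _ Qb Qa.
  move: ua ub; rewrite !ltr_norml ler_norml => /andP[u1 u2] /andP[u3 u4].
  by apply/andP; split; [lra_from u1 u2 u3 u4 o2|lra_from u1 u2 u3 u4 o1].
apply: le_trans main _.
have h1 : r `^ alpha <= 2 * (Dx `^ alpha + (B `^ kappa^-1) `^ alpha).
  by apply: powR_add_le => //; rewrite a1 ltW.
have h2 : (B `^ kappa^-1) `^ alpha <= 2 * KK * Dt `^ (alpha / kappa).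
  have KK2 : 1 <= 2 * KK by lra_from KK1.
  rewrite -powRrM mulrC /B powRM ?(le_trans ler01 KK2)//.
  rewrite ler_wpM2r ?powR_ge0//; apply: ler1_powR => //.
  by rewrite ler_pdivrMr// mul1r.
have X0 : 0 <= Dx `^ alpha := powR_ge0 _ _.
have Y0 : 0 <= Dt `^ (alpha / kappa) := powR_ge0 _ _.
set X := Dx `^ alpha in h1 X0 *; set Y := Dt `^ _ in h2 Y0 *.
have h3 : K * r `^ alpha <= K * (2 * (X + 2 * KK * Y)).
  by rewrite ler_wpM2l ?(ltW K0)//; lra_from h1 h2.
apply: le_trans h3 _.
have : 0 <= K * X * (4 * KK - 2) by rewrite !mulr_ge0 ?(ltW K0)//; lra_from KK1.
clear; lra.
Qed.

(** * Choice of the exponent and of the constants *)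

Unset Implicit Arguments.

Theorem theorem1p1 (R : realType) (N : nat) (q p delta M : R)
    (hN : (1 <= N)%N) (hq : 2 < q) (hp : p^-1 + q^-1 = 1)
    (hdelta : 1 <= delta) (hM : 0 < M) :
  exists2 theta : R, p < theta &
  forall tau : R, 0 < tau ->
  exists2 C : R, 0 < C &
  forall (T : R) (u : 'rV[R]_N * R -> R),
    0 < T -> tau < T ->
    {within closed_slab T, continuous u} ->
    viscosity_supersolution (F_super q delta) T u ->
    viscosity_subsolution (F_sub q delta) T u ->
    (forall z, closed_slab T z -> `|u z| <= M) ->
    forall (x1 x2 : 'rV[R]_N) (t1 t2 : R),
      t1 \in `[tau, T] -> t2 \in `[tau, T] ->
      `|u (x1, t1) - u (x2, t2)| <=
        C * (enorm (x1 - x2) `^ ((theta - p) / (theta - 1)) +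
             `|t1 - t2| `^ ((theta - p) / theta)).
Proof.
have q0 : q != 0 by lra.
have p0 : p != 0.
  apply/eqP => p0; move: hp; rewrite p0 invr0 add0r => /eqP.
  by rewrite invr_eq1 => /eqP; lra.
have pq : (p - 1) * q = p.
  have : (p^-1 + q^-1) * (p * q) = p * q by rewrite hp mul1r.
  have -> : (p^-1 + q^-1) * (p * q) = q + p by field; rewrite q0.
  by lra.
have pq1 : (p - 1) * (q - 1) = 1 by lra.
have p1 : 1 < p.
  by rewrite -subr_gt0 -(pmulr_lgt0 _ (_ : 0 < q - 1)) ?pq1//; lra.
have p2 : p < 2.
  have : 0 < (p - 1) * (q - 2) by rewrite mulr_gt0//; lra.
  lra.
pose C1 := growth_constant p delta.
have C11 : 1 <= C1 by exact: growth_constant_ge1.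
have d0 : 0 < delta by exact: lt_le_trans ltr01 hdelta.
pose eps := (64 * C1)^-1; pose eta := eps ^+ 2 / (64 * delta).
have e0 : 0 < eps by rewrite invr_gt0; lra.
have eta0 : 0 < eta by rewrite divr_gt0 ?exprn_gt0//; lra.
(* The first bound gives the contraction of one step and implies alpha <= eta, the second gives
   kappa >= 2. Neither involves tau, so theta is fixed before tau. *)
pose alpha := Num.min (eta * (eps / 2) / 2) (2 - p).
have a0 : 0 < alpha.
  rewrite lt_min; apply/andP; split; last by lra.
  by apply: divr_gt0 => //; apply: mulr_gt0 => //; exact: divr_gt0.
have [al ap] : alpha <= eta * (eps / 2) / 2 /\ alpha <= 2 - p.
  by rewrite /alpha !ge_min !lexx orbT.
have a1 : alpha < 1 by lra.
pose kappa := alpha + (1 - alpha) * q.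
have k2 : 2 <= kappa by exact: kappa_ge2 p1 hq pq ap.
pose theta := (p - alpha) / (1 - alpha).
have thetap : theta - p = alpha * (p - 1) / (1 - alpha).
  by rewrite /theta; field; lra.
have theta1 : theta - 1 = (p - 1) / (1 - alpha) by rewrite /theta; field; lra.
have kp : kappa * (p - 1) = p - alpha.
  have : (1 - alpha) * ((p - 1) * q - p) = 0 by rewrite pq subrr mulr0.
  by rewrite /kappa; lra.
have e1 : (theta - p) / (theta - 1) = alpha.
  by rewrite thetap theta1; field; apply/andP; split; lra_from p1 a1.
have e2 : (theta - p) / theta = alpha / kappa.
  have -> : kappa = (p - alpha) / (p - 1) by rewrite -kp mulfK//; lra.
  by rewrite thetap /theta; field; do ?[apply/andP; split]; lra_from p1 a0 a1.
exists theta.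
  by rewrite -subr_gt0 thetap divr_gt0 ?mulr_gt0 ?subr_gt0//.
move=> tau tau0.
(* One summand per lower bound on K: 4 M starts the induction, 1 / tau leaves room below t0 for the
   cylinders of radius at most 1, and the terms with C1 and delta absorb the lower order terms. *)
pose K := 1 + 4 * M + 8 * C1 + 16 * delta / eps ^+ 2 + 16 * delta / eta + tau^-1.
have k3 : 0 < 16 * delta / eps ^+ 2 by rewrite divr_gt0 ?exprn_gt0 ?mulr_gt0//.
have k4 : 0 < 16 * delta / eta by apply: divr_gt0 => //; exact: mulr_gt0.
have k5 : 0 < tau^-1 by rewrite invr_gt0.
have [K1 KM KC] : [/\ 1 <= K, 4 * M <= K & 8 * C1 <= K].
  by split; rewrite /K; lra_from hM C11 k3 k4 k5.
have [Ke Keta Ktau] : [/\ 16 * delta / eps ^+ 2 <= K, 16 * delta / eta <= K & tau^-1 <= K].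
  by split; rewrite /K; lra_from hM C11 k3 k4 k5.
have K0 : 0 < K by exact: lt_le_trans ltr01 K1.
exists (4 * K * K `^ (q - 1)).
  by rewrite mulr_gt0 ?powR_gt0// mulr_gt0//.
move=> T u T0 tauT cu usup usub uM x1 x2 t1 t2.
rewrite !in_itv /= => /andP[tt1 t1T] /andP[tt2 t2T].
rewrite e1 e2.
have osc x0 t0 r : tau <= t0 <= T -> 0 < r -> osc_bound q alpha kappa K u x0 t0 r.
  move=> /andP[h1 h2] r0.
  apply: (oscillation_decay p1 p2 hq pq hdelta cu uM usup usub erefl erefl a0 ap al
    K1 KC Ke Keta KM h2 _ r0).
  apply: le_trans h1; rewrite -[leRHS]invrK lef_pV2 ?posrE//.
have q1 : 1 <= q by lra_from hq.
have ak : alpha <= kappa by lra_from a1 k2.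
have holder := osc_bound_holder cu q1 a0 (ltW a1) ak K1 tau0 osc.
have [t12|/ltW t21] := leP t1 t2; first exact: holder.
by rewrite distrC -(enormN (x1 - x2)) opprB (distrC t1); exact: holder.
Qed.
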